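(* Let $F$ be Thompson's group with standard generators $\mathsf{x}_0,\mathsf{x}_1$. Let $(g_n)_{n\in\mathbb{N}}$ be a sequence of elements of $F$ such that the sequence of marked groups $G_n=(F,(g_n,\mathsf{x}_0,\mathsf{x}_1))$ converges, and let $(G,(g,\mathsf{x}_0,\mathsf{x}_1))$ be its limit. Then $G$ is not an HNN-extension of $F$ of the form $$F*_{\alpha}=\langle F, g \mid ghg^{-1}=\alpha(h),\ h\in H\rangle ,$$ where $H$ is a finitely generated subgroup of $F$ and $\alpha$ is an embedding of $H$ into $F$.
   Context: Thompson's group $F$ is the group (under composition) of all increasing piecewise-linear homeomorphisms of $[0,1]$ that are differentiable except at finitely many dyadic rationals and whose slopes are integer powers of $2$. It is generated by $\mathsf{x}_0,\mathsf{x}_1$, where $\mathsf{x}_0(t)=\frac12 t$ on $[0,\frac12]$, $t-\frac14$ on $[\frac12,\frac34]$, $2t-1$ on $[\frac34,1]$; and $\mathsf{x}_1(t)=t$ on $[0,\frac12]$, $\frac12 t+\frac14$ on $[\frac12,\frac34]$, $t-\frac18$ on $[\frac34,\frac78]$, $2t-1$ on $[\frac78,1]$. Marked groups: a marked group $(G,(s_1,\dots,s_m))$ is a group with an ordered tuple of generators, considered up to isomorphism of marked groups. On the set $\mathcal{G}_m$ of groups marked by $m$ generators, two marked groups are at distance at most $e^{-r}$ if they have exactly the same relations of length at most $r$. Thus $(G_n,S_n)\to(G,S)$ iff for every word $w$ of the free group on $m$ letters: if $w(S)=1$ in $G$ then $w(S_n)=1$ in $G_n$ for all sufficiently large $n$,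 and if $w(S)\ne1$ in $G$ then $w(S_n)\neq1$ in $G_n$ for all sufficiently large $n$. In the limit $G$, the subgroup $\langle\mathsf{x}_0,\mathsf{x}_1\rangle$ is a copy of $F$ and is identified with $F$. That $G$ is of the form $F*_\alpha$ means that the homomorphism from the HNN-extension $\langle F,g\mid ghg^{-1}=\alpha(h),\ h\in H\rangle$ to $G$ which is the identity on $F$ and sends the stable letter $g$ to the limit element $g\in G$ is well defined and is an isomorphism. *)

(* Defs.v *)
From HB Require Import structures.
From mathcomp Require Import all_boot all_order all_algebra.
From mathcomp Require Import generic_quotient lra ring.
From mathcomp Require Import all_classical all_reals all_analysis.

Set Implicit Arguments.
Unset Strict Implicit.
Unset Printing Implicit Defensive.

Import Order.TTheory GRing.Theory Num.Theory.
Import numFieldNormedType.Exports.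
Local Open Scope classical_set_scope.
Local Open Scope ring_scope.

Section ThompsonFun.
Context {R : realType}.
Implicit Types (f g : R -> R) (s : seq R) (a b c x y : R).

Definition dyadic x := exists (a : int) (n : nat), x = a%:~R / 2 ^+ n.

(* The inverse of a continuous bijection of a compact interval is continuous,
   so that it is not mentioned. *)
Definition increasing_homeo01 f :=
  [/\ set_bij `[0, 1] `[0, 1] f,
      {in `[0, 1] &, {homo f : x y / x < y}} &
      {within `[0, 1], continuous f}].

Definition affine_pow2 f a b :=
  exists (k : int) (c : R), forall x, a <= x <= b -> f x = 2 ^ k * x + c.

(* [s] is a finite set of break points, listed in any order: [f] is affine on
   each closed interval whose interior contains none of them. *)
Definition pl_pow2_with s f :=
  forall a b, 0 <= a -> a < b -> b <= 1 ->
    (forall c, c \in s -> ~~ (a < c < b)) -> affine_pow2 f a b.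

Definition pl_pow2 f := exists s, pl_pow2_with s f.

(* The end points 0 and 1 are dyadic, so only the open interval matters. *)
Definition derivable_off_dyadics f := exists s,
  (forall x, x \in s -> dyadic x) /\
  (forall x, 0 < x < 1 -> x \notin s -> derivable f x 1).

(* A self-map of [0,1] is represented by its extension to R by the identity. *)
Definition thompson_fun f :=
  [/\ forall x, ~~ (0 <= x <= 1) -> f x = x,
      increasing_homeo01 f, pl_pow2 f & derivable_off_dyadics f].

Lemma affine_glue f a p b : a < p -> p < b -> affine_pow2 f a p ->
  affine_pow2 f p b -> derivable f p 1 -> affine_pow2 f a b.
Proof.
move=> ap pb [k [c fk]] [l [d fl]] /cvg_ex[/= L /cvgrPdist_lt dL].
have kl : 2 ^ k = 2 ^ l :> R.
  apply/eqP; rewrite -subr_eq0 -normr_le0 leNgt; apply/negP => e0.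
  have {dL} := dL _ (divr_gt0 e0 (ltr0Sn R 1)).
  rewrite near_withinE => /nbhs_ballP[d0 /= d0_gt0 H].
  pose h := Num.min (d0 / 2) (Num.min (p - a) (b - p)).
  have h0 : 0 < h by rewrite !lt_min; apply/and3P; split; lra.
  have hd : h < d0 by rewrite gt_min; apply/orP; left; lra.
  have ha : h <= p - a by rewrite !ge_min lexx orbT.
  have hb : h <= b - p by rewrite !ge_min lexx !orbT.
  have h_neq0 : h != 0 by rewrite gt_eqF.
  have := H h; have := H (- h).
  rewrite /ball /= !sub0r opprK normrN gtr0_norm// oppr_eq0 h_neq0.
  move=> /(_ hd isT) H1 /(_ hd isT) H2; move: H1 H2.
  rewrite /GRing.scale /= !mulr1.
  have -> : f (- h + p) - f p = 2 ^ k * (- h).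
    by rewrite !fk; [ring|apply/andP; split; lra|apply/andP; split; lra].
  have -> : f (h + p) - f p = 2 ^ l * h.
    by rewrite !fl; [ring|apply/andP; split; lra|apply/andP; split; lra].
  rewrite mulrCA mulVf ?oppr_eq0// mulr1 mulrCA mulVf// mulr1.
  set e := `|_ - _| in e0 * => H1 H2.
  have : e <= `|L - 2 ^ k| + `|L - 2 ^ l|.
    by rewrite -(normrN (L - _)) (le_trans _ (ler_normD _ _))// /e opprB addrA subrK.
  lra.
exists k, c => x /andP[ax xb].
have [xp|px] := leP x p; first by rewrite fk// ax.
rewrite fl ?(ltW px)// -kl; congr (_ + _).
have := fk p; have := fl p; rewrite !lexx !(ltW ap) !(ltW pb) kl => -> // /(_ isT).
by move/addrI.
Qed.

Lemma pl_ind s (P : R -> R -> Prop) :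
  (forall a b, a < b -> (forall c, c \in s -> ~~ (a < c < b)) -> P a b) ->
  (forall a p b, p \in s -> a < p -> p < b -> P a p -> P p b -> P a b) ->
  forall a b, a < b -> P a b.
Proof.
move=> P0 P1 a b; have [n] := ubnP (count (fun c => a < c < b) s).
elim: n a b => // n IH a b; rewrite ltnS => cn ab.
have [/hasP[p ps /andP[ap pb]]|/hasPn nh] := boolP (has (fun c => a < c < b) s).
  have lt_count a' b' : (forall c, a' < c < b' -> a < c < b) -> ~~ (a' < p < b') ->
      (count (fun c => (a' < c < b')%R) s < n)%N.
    move=> sub np; apply: leq_trans cn.
    rewrite (@eq_count _ (fun c => a < c < b)
      (predU (fun c => a' < c < b') (fun c => (a < c < b) && ~~ (a' < c < b')))); last first.
      by move=> c /=; case: (boolP (a' < c < b')) => [/sub->//|_]; rewrite andbT.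
    have /= := count_predUI (fun c => a' < c < b')
       (fun c => (a < c < b) && ~~ (a' < c < b')) s.
    rewrite [X in (_ + X)%N](@eq_count _ _ pred0) ?count_pred0 ?addn0; last first.
      by move=> c /=; case: (a' < c < b'); rewrite ?andbF.
    move=> ->; rewrite -[X in (X < _)%N]addn0 ltn_add2l -has_count.
    by apply/hasP; exists p => //=; rewrite ap pb np.
  apply: (P1 a p b) => //; apply: IH => //; apply: lt_count.
  - by move=> c /andP[-> cp] /=; apply: lt_trans pb.
  - by rewrite ltxx andbF.
  - by move=> c /andP[pc ->]; rewrite andbT; apply: lt_trans pc.
  - by rewrite ltxx.
exact: P0.
Qed.

Lemma avoid_nbhs s x : x \notin s ->
  exists2 e, 0 < e & forall c, c \in s -> ~~ (x - e < c < x + e).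
Proof.
elim: s => [|y s IH]; first by exists 1.
rewrite inE negb_or => /andP[xy /IH[e e0 He]].
exists (Num.min e `|x - y|); first by rewrite lt_min e0 normr_gt0 subr_eq0.
move=> c; rewrite inE => /predU1P[->|/He]; rewrite -!ltr_distlC.
  by rewrite lt_min distrC ltxx andbF.
by rewrite lt_min => /negbTE->.
Qed.

Definition dyadic_pl f := exists2 s, (forall x, x \in s -> dyadic x) &
  pl_pow2_with s f.

Lemma dyadic_plP f : dyadic_pl f <-> pl_pow2 f /\ derivable_off_dyadics f.
Proof.
split=> [[s sd sf]|[[s sf] [D [Dd Df]]]].
  split; exists s => //; split=> // x /andP[x0 x1] xs.
  have [e e0 He] := avoid_nbhs xs.
  pose h := Num.min e (Num.min x (1 - x)).
  have h0 : 0 < h by rewrite !lt_min; apply/and3P; split; lra.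
  have he : h <= e by rewrite ge_min lexx.
  have hx : h <= x by rewrite !ge_min lexx orbT.
  have hx1 : h <= 1 - x by rewrite !ge_min lexx !orbT.
  have [||||k [d fE]] := sf (x - h) (x + h); [lra|lra|lra| |].
    move=> c /He; apply: contra => /andP[? ?]; apply/andP; split; lra.
  apply: (@near_eq_derivable _ _ _ (fun y => 2 ^ k * y + d)).
  - near=> y; rewrite fE//.
    have : `|x - y| < h by near: y; apply: cvgr_dist_lt => //; exact: cvg_id.
    by rewrite ltr_norml => /andP[? ?]; apply/andP; split; lra.
  - apply: derivableD; last exact: derivable_cst.
    apply: derivableM; [exact: derivable_cst|exact: derivable_id].
exists D => // a b a0 ab b1 avD.
suff : 0 <= a -> b <= 1 -> (forall c, c \in D -> ~~ (a < c < b)) -> affine_pow2 f a b by exact.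
move: a b ab {a0 b1 avD}; apply: (@pl_ind s) => [a b ab av a0 b1 _|a p b _ ap pb IH1 IH2 a0 b1 av].
  exact: sf.
apply: (affine_glue ap pb).
- apply: IH1 => //; first by rewrite (le_trans (ltW pb)).
  by move=> c /av; apply: contra => /andP[-> cp]/=; apply: lt_trans pb.
- apply: IH2 => //; first by rewrite (le_trans a0) ?ltW.
  by move=> c /av; apply: contra => /andP[pc ->]; rewrite andbT; apply: lt_trans pc.
- apply: Df; first by rewrite (le_lt_trans a0)//= (lt_le_trans pb).
  by apply/negP => /av; rewrite ap pb.
Unshelve. all: by end_near.
Qed.

Lemma dyadicD x y : dyadic x -> dyadic y -> dyadic (x + y).
Proof.
move=> [a [n ->]] [b [m ->]]; exists (a * 2 ^+ m + b * 2 ^+ n), (n + m)%N.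
rewrite rmorphD !rmorphM !rmorphXn /= exprD.
by field; rewrite !expf_neq0 ?pnatr_eq0.
Qed.

Lemma dyadicM x y : dyadic x -> dyadic y -> dyadic (x * y).
Proof.
move=> [a [n ->]] [b [m ->]]; exists (a * b), (n + m)%N.
by rewrite rmorphM /= exprD; field; rewrite !expf_neq0 ?pnatr_eq0.
Qed.

Lemma dyadicN x : dyadic x -> dyadic (- x).
Proof. by move=> [a [n ->]]; exists (- a), n; rewrite rmorphN mulNr. Qed.

Lemma dyadic_int (a : int) : dyadic a%:~R.
Proof. by exists a, 0%N; rewrite expr0 divr1. Qed.

Lemma dyadic0 : dyadic 0. Proof. exact: (dyadic_int 0). Qed.

Lemma dyadic_pow2 (k : int) : dyadic (2 ^ k).
Proof.
case: k => n; last by exists 1, n.+1; rewrite div1r.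
by exists (2 ^+ n), 0%N; rewrite expr0 divr1 rmorphXn.
Qed.

(* A more convenient form of [thompson_fun], in which the break points are
   themselves dyadic and the inverse is explicit. *)
Definition thompson_inv f g :=
  [/\ cancel f g, cancel g f, {mono f : x y / x <= y},
      forall x, ~~ (0 <= x <= 1) -> f x = x & f 0 = 0] /\ (f 1 = 1 /\ dyadic_pl f).

Lemma thompson_funP f : thompson_fun f <-> exists g, thompson_inv f g.
Proof.
split=> [[fid [[fmap finj fsurj] finc _] pl df]|[g [[fg gf fm fid f0] [f1 dpl]]]].
  have fI x : 0 <= x <= 1 -> 0 <= f x <= 1.
    by move=> xI; have /= := fmap x; rewrite !in_itv /=; apply.
  have f0 : f 0 = 0.
    have [|x /=] := fsurj 0; first by rewrite /= in_itv /= lexx ler01.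
    rewrite in_itv /= => /andP[+ x1]; rewrite le_eqVlt => /predU1P[<-//|x0 fx].
    have := finc 0 x; rewrite !in_itv /= lexx ler01 x1 (ltW x0) => /(_ isT isT x0).
    by rewrite fx ltNge; have /andP[->] : 0 <= f 0 <= 1 by rewrite fI// lexx ler01.
  have f1 : f 1 = 1.
    have [|x /=] := fsurj 1; first by rewrite /= in_itv /= lexx ler01.
    rewrite in_itv /= => /andP[x0]; rewrite le_eqVlt => /predU1P[<-//|x1 fx].
    have := finc x 1; rewrite !in_itv /= lexx ler01 x0 (ltW x1) => /(_ isT isT x1).
    by rewrite fx ltNge; have /andP[_ ->] : 0 <= f 1 <= 1 by rewrite fI// lexx ler01.
  have flt : {homo f : x y / x < y}.
    move=> x y xy.
    have [xI|xI] := boolP (0 <= x <= 1); have [yI|yI] := boolP (0 <= y <= 1).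
    - by apply: finc.
    - rewrite (fid y)//; have /andP[_ ?] := fI _ xI.
      by move: yI xI; rewrite negb_and -!ltNge => /orP[?|?] /andP[? ?]; lra.
    - rewrite (fid x)//; have /andP[? ?] := fI _ yI.
      by move: xI yI; rewrite negb_and -!ltNge => /orP[?|?] /andP[? ?]; lra.
    - by rewrite !fid.
  have fm : {mono f : x y / x <= y} by apply: le_mono.
  have fs y : exists x, f x = y.
    have [yI|yI] := boolP (0 <= y <= 1); last by exists y; apply: fid.
    by have [|x _ <-] := fsurj y; [rewrite /= in_itv|exists x].
  have [g gf] := choice fs.
  exists g; split; last by split=> //; apply/dyadic_plP.
  by split=> // x; apply: (inc_inj fm); rewrite gf.
split=> //; last 2 first.
- by have [] := (dyadic_plP f).1 dpl.
- by have [] := (dyadic_plP f).1 dpl.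
have sI : set_surj `[0, 1] `[0, 1] f.
  move=> y /=; rewrite in_itv /= => /andP[y0 y1]; exists (g y); rewrite ?gf//=.
  by rewrite in_itv /= -(fm 0) -(fm _ 1) gf f0 f1 y0.
split.
- split=> //.
    move=> x /=; rewrite !in_itv /= => /andP[x0 x1].
    by apply/andP; split; [rewrite -f0 fm|rewrite -f1 fm].
  by move=> x y _ _ /(congr1 g); rewrite !fg.
- by move=> x y _ _; rewrite (leW_mono fm).
- apply: segment_inc_surj_continuous; first by move=> x y _ _; rewrite fm.
  by rewrite f0 f1.
Qed.

Lemma dyadic_image f g x : thompson_inv f g -> dyadic x -> 0 <= x <= 1 ->
  dyadic (f x).
Proof.
move=> [[_ _ fm fid f0] [_ [s sd sf]]] dx /andP[+ x1].
rewrite le_eqVlt => /predU1P[<-|x0]; first by rewrite f0; exact: dyadic0.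
suff H a b : a < b -> dyadic a -> dyadic b -> 0 <= a -> b <= 1 ->
    dyadic (f b - f a).
  by rewrite -[f x]subr0 -f0; apply: H => //; exact: dyadic0.
move: a b; apply: (@pl_ind s).
  move=> a b ab av da db a0 b1; have [k [c fE]] := sf a b a0 ab b1 av.
  have -> : f b - f a = 2 ^ k * (b - a) by rewrite !fE ?lexx ?ltW//; ring.
  by apply: dyadicM; [exact: dyadic_pow2|apply: dyadicD => //; exact: dyadicN].
move=> a p b ps ap pb IH1 IH2 da db a0 b1.
rewrite -(subrK (f p) (f b)) -addrA; apply: dyadicD.
  by apply: IH2 => //; [exact: sd|rewrite (le_trans a0) ?ltW].
by apply: IH1 => //; [exact: sd|rewrite (le_trans (ltW pb))].
Qed.

Lemma thompson_invV f g : thompson_inv f g -> thompson_inv g f.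
Proof.
move=> fgP; have [[fg gf fm fid f0] [f1 [s sd sf]]] := fgP.
have gm : {mono g : x y / x <= y} by move=> x y; rewrite -fm !gf.
have g0 : g 0 = 0 by rewrite -{1}f0 fg.
have g1 : g 1 = 1 by rewrite -{1}f1 fg.
do 2?split=> //; first by move=> x xI; rewrite -{1}(fid x xI) fg.
exists [seq f c | c <- s & 0 <= c <= 1].
  move=> _ /mapP[c + ->]; rewrite mem_filter => /andP[cI cs].
  by apply: (dyadic_image fgP) => //; exact: sd.
move=> a b a0 ab b1 av.
have [||||k [d fE]] := sf (g a) (g b).
- by rewrite -g0 gm.
- by rewrite (leW_mono gm).
- by rewrite -g1 gm.
- move=> c cs; apply/negP => /andP[ac cb]; have := av (f c).
  rewrite -(leW_mono fm) gf in ac; rewrite -(leW_mono fm) gf in cb.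
  rewrite ac cb => /(_ _)/negP; apply=> //; apply: map_f.
  by rewrite mem_filter cs andbT -(fm 0) -(fm _ 1) f0 f1; apply/andP; split; lra.
exists (- k), (- (2 ^ (- k) * d)) => x /andP[ax xb].
have xE : x = 2 ^ k * g x + d by rewrite -fE ?gm ?ax// gf.
rewrite [in RHS]xE -invr_expz mulrDr mulrA mulVf ?mul1r ?addrK//.
by rewrite expfz_neq0// pnatr_eq0.
Qed.

Lemma thompson_invM f f' g g' : thompson_inv f f' -> thompson_inv g g' ->
  thompson_inv (f \o g) (g' \o f').
Proof.
move=> ffP ggP; have [[ff' f'f fm fid f0] [f1 [s sd sf]]] := ffP.
have [[gg' g'g gm gid g0] [g1 [t td tg]]] := ggP.
do 2?split=> //=.
- exact: can_comp.
- exact: can_comp.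
- by move=> x y /=; rewrite fm gm.
- by move=> x xI /=; rewrite gid// fid.
- by rewrite g0.
- by rewrite g1.
have g'P := thompson_invV ggP.
exists (t ++ [seq g' c | c <- s & 0 <= c <= 1]).
  move=> x; rewrite mem_cat => /orP[/td//|/mapP[c + ->]].
  rewrite mem_filter => /andP[cI cs].
  by apply: (dyadic_image g'P) => //; exact: sd.
move=> a b a0 ab b1 av.
have [//||k [d gE]] := tg a b a0 ab.
  by move=> c ct; apply: av; rewrite mem_cat ct.
have ga0 : 0 <= g a by rewrite -g0 gm.
have gb1 : g b <= 1 by rewrite -g1 gm.
have [//||//||l [e fE]] := sf (g a) (g b).
- by rewrite (leW_mono gm).
- move=> c cs; apply/negP => /andP[ac cb]; have := av (g' c).
  rewrite mem_cat map_f ?orbT; last first.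
    by rewrite mem_filter cs andbT; apply/andP; split; lra.
  by rewrite -(leW_mono gm) -(leW_mono gm _ b) g'g ac cb => /(_ isT).
exists (l + k), (2 ^ l * d + e) => x /andP[ax xb].
have two0 : (2 : R) != 0 by rewrite pnatr_eq0.
rewrite compE fE; last by rewrite !gm ax.
rewrite gE; last by rewrite ax.
by rewrite (expfzDr _ _ two0) mulrDr mulrA addrA.
Qed.

Lemma thompson_inv1 : thompson_inv id id.
Proof.
do 2?split=> //; exists [::] => // a b _ _ _ _.
by exists 0, 0 => x _; rewrite expr0z mul1r addr0.
Qed.

Definition x0_fun t : R :=
  if ~~ (0 <= t <= 1) then t
  else if t <= 1 / 2 then t / 2
  else if t <= 3 / 4 then t - 1 / 4
  else 2 * t - 1.

Definition x1_fun t : R :=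
  if ~~ (0 <= t <= 1) then t
  else if t <= 1 / 2 then t
  else if t <= 3 / 4 then t / 2 + 1 / 4
  else if t <= 7 / 8 then t - 1 / 8
  else 2 * t - 1.

Let x0_inv t : R :=
  if ~~ (0 <= t <= 1) then t
  else if t <= 1 / 4 then 2 * t
  else if t <= 1 / 2 then t + 1 / 4
  else (t + 1) / 2.

Let x1_inv t : R :=
  if ~~ (0 <= t <= 1) then t
  else if t <= 1 / 2 then t
  else if t <= 5 / 8 then 2 * t - 1 / 2
  else if t <= 3 / 4 then t + 1 / 8
  else (t + 1) / 2.

Variant pieces3 p q t (v0 v1 v2 : R) : R -> Prop :=
| Piece3L of t < 0 : pieces3 p q t v0 v1 v2 t
| Piece3R of 1 < t : pieces3 p q t v0 v1 v2 t
| Piece31 of 0 <= t & t <= p : pieces3 p q t v0 v1 v2 v0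
| Piece32 of p < t & t <= q : pieces3 p q t v0 v1 v2 v1
| Piece33 of q < t & t <= 1 : pieces3 p q t v0 v1 v2 v2.

Variant pieces4 p q r t (v0 v1 v2 v3 : R) : R -> Prop :=
| Piece4L of t < 0 : pieces4 p q r t v0 v1 v2 v3 t
| Piece4R of 1 < t : pieces4 p q r t v0 v1 v2 v3 t
| Piece41 of 0 <= t & t <= p : pieces4 p q r t v0 v1 v2 v3 v0
| Piece42 of p < t & t <= q : pieces4 p q r t v0 v1 v2 v3 v1
| Piece43 of q < t & t <= r : pieces4 p q r t v0 v1 v2 v3 v2
| Piece44 of r < t & t <= 1 : pieces4 p q r t v0 v1 v2 v3 v3.

Let pieces3P p q t v0 v1 v2 : pieces3 p q t v0 v1 v2
  (if ~~ (0 <= t <= 1) then t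
   else if t <= p then v0 else if t <= q then v1 else v2).
Proof.
case: (leP 0 t) => t0 /=; last by constructor.
case: (leP t 1) => t1 /=; last by constructor.
case: (leP t p) => tp; first by constructor.
by case: (leP t q) => tq; constructor.
Qed.

Let pieces4P p q r t v0 v1 v2 v3 : pieces4 p q r t v0 v1 v2 v3
  (if ~~ (0 <= t <= 1) then t
   else if t <= p then v0 else if t <= q then v1 else if t <= r then v2 else v3).
Proof.
case: (leP 0 t) => t0 /=; last by constructor.
case: (leP t 1) => t1 /=; last by constructor.
case: (leP t p) => tp; first by constructor.
case: (leP t q) => tq; first by constructor.
by case: (leP t r) => tr; constructor.
Qed.

Let x0P t : pieces3 (1 / 2) (3 / 4) t (t / 2) (t - 1 / 4) (2 * t - 1) (x0_fun t).
Proof. exact: pieces3P. Qed.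

Let x0iP t : pieces3 (1 / 4) (1 / 2) t (2 * t) (t + 1 / 4) ((t + 1) / 2) (x0_inv t).
Proof. exact: pieces3P. Qed.

Let x1P t : pieces4 (1 / 2) (3 / 4) (7 / 8) t t (t / 2 + 1 / 4) (t - 1 / 8)
  (2 * t - 1) (x1_fun t).
Proof. exact: pieces4P. Qed.

Let x1iP t : pieces4 (1 / 2) (5 / 8) (3 / 4) t t (2 * t - 1 / 2) (t + 1 / 8)
  ((t + 1) / 2) (x1_inv t).
Proof. exact: pieces4P. Qed.

Let dyadic_frac (a n : nat) : dyadic (a%:R / 2 ^+ n).
Proof. by exists a%:Z, n. Qed.

Let affineI f a b (k : int) c :
  (forall x, a <= x -> x <= b -> f x = 2 ^ k * x + c) -> affine_pow2 f a b.
Proof. by move=> H; exists k, c => x /andP[]; exact: H. Qed.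

Lemma x0_funP : thompson_fun x0_fun.
Proof.
apply/thompson_funP; exists x0_inv; split; first split.
- by move=> x; case: (x0P x) => *; case: x0iP => *; lra.
- by move=> x; case: (x0iP x) => *; case: x0P => *; lra.
- by apply: le_mono => x y xy; case: (x0P x) => *; case: (x0P y) => *; lra.
- by move=> x xI; rewrite /x0_fun xI.
- by case: x0P => *; lra.
split; first by case: x0P => *; lra.
exists [:: 1 / 2; 3 / 4].
  move=> x; rewrite !inE => /orP[]/eqP->; first exact: (dyadic_frac 1 1).
  by rewrite (_ : 4 = 2 ^+ 2); [exact: (dyadic_frac 3 2)|rewrite -natrX].
move=> a b a0 ab b1 av; have := av (1 / 2); have := av (3 / 4).
rewrite !inE !eqxx !orbT !negb_and -!leNgt.
move=> /(_ isT)/orP H2 /(_ isT)/orP H1 {av}.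
case: H1 => ?; last first.
  by apply: (@affineI _ _ _ (- 1) 0) => x ? ?; rewrite exprN1; case: x0P => *; lra.
case: H2 => ?; last first.
  by apply: (@affineI _ _ _ 0 (- (1 / 4))) => x ? ?; rewrite expr0z; case: x0P => *; lra.
by apply: (@affineI _ _ _ 1 (- 1)) => x ? ?; rewrite expr1z; case: x0P => *; lra.
Qed.

Lemma x1_funP : thompson_fun x1_fun.
Proof.
apply/thompson_funP; exists x1_inv; split; first split.
- by move=> x; case: (x1P x) => *; case: x1iP => *; lra.
- by move=> x; case: (x1iP x) => *; case: x1P => *; lra.
- by apply: le_mono => x y xy; case: (x1P x) => *; case: (x1P y) => *; lra.
- by move=> x xI; rewrite /x1_fun xI.
- by case: x1P => *; lra.
split; first by case: x1P => *; lra.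
exists [:: 1 / 2; 3 / 4; 7 / 8].
  move=> x; rewrite !inE => /or3P[]/eqP->.
  - exact: (dyadic_frac 1 1).
  - by rewrite (_ : 4 = 2 ^+ 2); [exact: (dyadic_frac 3 2)|rewrite -natrX].
  - by rewrite (_ : 8 = 2 ^+ 3); [exact: (dyadic_frac 7 3)|rewrite -natrX].
move=> a b a0 ab b1 av.
have := av (1 / 2); have := av (3 / 4); have := av (7 / 8).
rewrite !inE !eqxx !orbT !negb_and -!leNgt.
move=> /(_ isT)/orP H3 /(_ isT)/orP H2 /(_ isT)/orP H1 {av}.
case: H1 => ?; last first.
  by apply: (@affineI _ _ _ 0 0) => x ? ?; rewrite expr0z; case: x1P => *; lra.
case: H2 => ?; last first.
  by apply: (@affineI _ _ _ (- 1) (1 / 4)) => x ? ?; rewrite exprN1; case: x1P => *; lra.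
case: H3 => ?; last first.
  by apply: (@affineI _ _ _ 0 (- (1 / 8))) => x ? ?; rewrite expr0z; case: x1P => *; lra.
by apply: (@affineI _ _ _ 1 (- 1)) => x ? ?; rewrite expr1z; case: x1P => *; lra.
Qed.

End ThompsonFun.

Record thompson (R : realType) := Thompson {
  thompson_val :> R -> R;
  _ : `[< thompson_fun thompson_val >] }.

HB.instance Definition _ (R : realType) := [isSub for @thompson_val R].
HB.instance Definition _ (R : realType) := [Choice of thompson R by <:].

Section ThompsonGroup.
Context {R : realType}.
Implicit Types f g h : thompson R.

Lemma thompsonP f : exists g : R -> R, thompson_inv f g.
Proof. by case: f => f fP; apply/thompson_funP/asboolP. Qed.

Definition thompson_of (f : R -> R) (fP : thompson_fun f) : thompson R :=
  Thompson (introT (asboolP _) fP).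

Definition thompson_one : thompson R :=
  thompson_of ((thompson_funP _).2 (ex_intro _ _ thompson_inv1)).

Fact thompson_mul_subproof f g : thompson_fun (f \o g).
Proof.
have [f' fP] := thompsonP f; have [g' gP] := thompsonP g.
by apply/thompson_funP; eexists; exact: thompson_invM fP gP.
Qed.

Definition thompson_mul f g := thompson_of (thompson_mul_subproof f g).

Fact thompson_invg_subproof f : thompson_fun (sval (cid (thompsonP f))).
Proof.
by case: cid => g /= fg; apply/thompson_funP; exists f; exact: thompson_invV.
Qed.

Definition thompson_invg f := thompson_of (thompson_invg_subproof f).

Fact thompson_mulA : associative thompson_mul.
Proof. by move=> f g h; apply: val_inj. Qed.

Fact thompson_mul1g : left_id thompson_one thompson_mul.
Proof. by move=> f; apply: val_inj. Qed.

Fact thompson_mulg1 : right_id thompson_one thompson_mul.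
Proof. by move=> f; apply: val_inj. Qed.

Fact thompson_mulVg : left_inverse thompson_one thompson_invg thompson_mul.
Proof.
move=> f; apply: val_inj => /=; apply/funext => x /=.
by case: cid => g [[fg _ _ _ _] _] /=; rewrite fg.
Qed.

Fact thompson_mulgV : right_inverse thompson_one thompson_invg thompson_mul.
Proof.
move=> f; apply: val_inj => /=; apply/funext => x /=.
by case: cid => g [[_ gf _ _ _] _] /=; rewrite gf.
Qed.

HB.instance Definition _ := isGroup.Build (thompson R)
  thompson_mulA thompson_mul1g thompson_mulg1 thompson_mulVg thompson_mulgV.

Definition x0 : thompson R := thompson_of x0_funP.
Definition x1 : thompson R := thompson_of x1_funP.

End ThompsonGroup.
Arguments x0 {R}.
Arguments x1 {R}.

Local Open Scope group_scope.

(* A letter [(x, e)] stands for x if [e] is false and for x^-1 otherwise.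
   Words need not be reduced: reduction does not increase the length. *)
Definition word (X : Type) := seq (X * bool).

Definition eval_letter (X : Type) (A : groupType) (s : X -> A) (l : X * bool) : A :=
  if l.2 then (s l.1)^-1 else s l.1.

Definition eval_word (X : Type) (A : groupType) (s : X -> A) (w : word X) : A :=
  \prod_(l <- w) eval_letter s l.

Definition subgroup (A : groupType) (K : set A) := group_closed [in K].

Definition generated (A : groupType) (S : set A) : set A := smallest (@subgroup A) S.

Definition finitely_generated (A : groupType) (K : set A) :=
  exists s : seq A, K = generated [set` s].

Definition marking (m : nat) (A : groupType) (t : m.-tuple A) :=
  generated [set` t] = [set: A].

(* The marked groups (A, t) and (B, u) are at distance at most e^(-r). *)
Definition marked_close (r m : nat) (A B : groupType)
    (t : m.-tuple A) (u : m.-tuple B) :=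
  forall w : word 'I_m, (size w <= r)%N ->
    (eval_word (tnth t) w = 1 <-> eval_word (tnth u) w = 1).

Definition marked_cvg (m : nat) (A_ : nat -> groupType)
    (t_ : forall n, m.-tuple (A_ n)) (B : groupType) (u : m.-tuple B) :=
  forall r, \forall n \near \oo, marked_close r (t_ n) u.

Lemma marked_cvgP (m : nat) (A_ : nat -> groupType)
    (t_ : forall n, m.-tuple (A_ n)) (B : groupType) (u : m.-tuple B) :
  marked_cvg t_ u <-> forall w : word 'I_m,
    (eval_word (tnth u) w = 1 ->
      \forall n \near \oo, eval_word (tnth (t_ n)) w = 1) /\
    (eval_word (tnth u) w <> 1 ->
      \forall n \near \oo, eval_word (tnth (t_ n)) w <> 1).
Proof.
split=> [cv w|H r].
  by split=> uw; apply: filterS (cv (size w)) => n /(_ w (leqnn _)) [? ?]; tauto.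
pose P (w : word 'I_m) n :=
  eval_word (tnth (t_ n)) w = 1 <-> eval_word (tnth u) w = 1.
have HP w : \forall n \near \oo, P w n.
  have [H1 H2] := H w; rewrite /P.
  have [uw|uw] := pselect (eval_word (tnth u) w = 1).
    by apply: filterS (H1 uw) => n ->.
  by apply: filterS (H2 uw) => n tw; split.
suff : \forall n \near \oo, forall w : {k : 'I_r.+1 & k.-tuple ('I_m * bool)%type},
    P (tagged w) n.
  apply: filterS => n Pn w wr.
  exact: (Pn (Tagged (fun k : 'I_r.+1 => k.-tuple _) (@in_tuple _ w : (@Ordinal r.+1 (size w) wr).-tuple _))).
by apply: filter_forall => w; exact: HP.
Unshelve. all: by end_near.
Qed.

Section Presentation.
Context {X : choiceType} (rel : word X -> word X -> Prop).

(* The congruence on words defining < X | v = w for all v, w with rel v w >. *)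
Inductive pres_eqv : word X -> word X -> Prop :=
| pres_rel v w : rel v w -> pres_eqv v w
| pres_cancel x e : pres_eqv [:: (x, e); (x, ~~ e)] [::]
| pres_cat v v' w w' :
    pres_eqv v v' -> pres_eqv w w' -> pres_eqv (v ++ w) (v' ++ w')
| pres_refl w : pres_eqv w w
| pres_sym v w : pres_eqv v w -> pres_eqv w v
| pres_trans u v w : pres_eqv u v -> pres_eqv v w -> pres_eqv u w.

Let eqv v w := `[< pres_eqv v w >].

Fact pres_eqv_equiv : equiv_class_of eqv.
Proof.
split=> [w|v w|v u w]; first exact/asboolP/pres_refl.
  by apply/asboolP/asboolP; exact: pres_sym.
by move=> /asboolP uv /asboolP vw; apply/asboolP; exact: pres_trans vw.
Qed.

Canonical pres_equivRel := EquivRelPack pres_eqv_equiv.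

Definition presented := {eq_quot pres_equivRel}%qT.
HB.instance Definition _ := Choice.on presented.

Definition pres_class (w : word X) : presented := \pi_presented%qT w.

Lemma pres_classP v w : pres_class v = pres_class w <-> pres_eqv v w.
Proof.
by split=> [/eqP|vw]; [rewrite /pres_class piE => /asboolP|apply/eqP; rewrite /pres_class piE; apply/asboolP].
Qed.

Definition pres_repr (a : presented) : word X := repr a.

Lemma pres_reprK : cancel pres_repr pres_class.
Proof. exact: reprK. Qed.

Lemma pres_classK w : pres_eqv (pres_repr (pres_class w)) w.
Proof. by apply/pres_classP; rewrite pres_reprK. Qed.

Definition word_inv (w : word X) : word X := rev [seq (l.1, ~~ l.2) | l <- w].

Lemma word_inv_cancel w : pres_eqv (w ++ word_inv w) [::].
Proof.
elim: w => [|[x e] w IH]; first exact: pres_refl.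
have -> : ((x, e) :: w) ++ word_inv ((x, e) :: w) =
    [:: (x, e)] ++ (w ++ word_inv w) ++ [:: (x, ~~ e)].
  by rewrite /word_inv /= rev_cons -cats1 catA.
apply: pres_trans (pres_cancel x e).
apply: (@pres_cat [:: (x, e)] [:: (x, e)]); first exact: pres_refl.
by apply: (@pres_cat _ [::]) => //; exact: pres_refl.
Qed.

Lemma word_invK : involutive word_inv.
Proof.
move=> w; rewrite /word_inv map_rev revK -map_comp map_id_in// => -[x e] _ /=.
by rewrite negbK.
Qed.

Definition pres_one : presented := pres_class [::].
Definition pres_mul (a b : presented) := pres_class (pres_repr a ++ pres_repr b).
Definition pres_inv (a : presented) := pres_class (word_inv (pres_repr a)).

Lemma pres_class_cat v w : pres_class (v ++ w) = pres_mul (pres_class v) (pres_class w).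
Proof. by apply/pres_classP/pres_cat; apply/pres_sym/pres_classK. Qed.

Fact pres_mulA : associative pres_mul.
Proof.
move=> a b c; rewrite -(pres_reprK a) -(pres_reprK b) -(pres_reprK c).
by rewrite -!pres_class_cat catA.
Qed.

Fact pres_mul1g : left_id pres_one pres_mul.
Proof. by move=> a; rewrite -(pres_reprK a) -pres_class_cat. Qed.

Fact pres_mulg1 : right_id pres_one pres_mul.
Proof. by move=> a; rewrite -(pres_reprK a) -pres_class_cat cats0. Qed.

Fact pres_mulgV : right_inverse pres_one pres_inv pres_mul.
Proof.
move=> a; rewrite -{1}(pres_reprK a) -pres_class_cat.
exact/pres_classP/word_inv_cancel.
Qed.

Fact pres_mulVg : left_inverse pres_one pres_inv pres_mul.
Proof.
move=> a; rewrite -{2}(pres_reprK a) -pres_class_cat -{2}(word_invK (pres_repr a)).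
exact/pres_classP/word_inv_cancel.
Qed.

HB.instance Definition _ := isGroup.Build presented
  pres_mulA pres_mul1g pres_mulg1 pres_mulVg pres_mulgV.

Definition pres_gen (x : X) : presented := pres_class [:: (x, false)].

Lemma pres_genM v w : pres_class (v ++ w) = pres_class v * pres_class w.
Proof. exact: pres_class_cat. Qed.

Lemma pres_genV x : pres_class [:: (x, true)] = (pres_gen x)^-1.
Proof.
apply: (mulgI (pres_gen x)); rewrite mulgV -pres_genM.
exact/pres_classP/pres_cancel.
Qed.

Lemma pres_eqv_eval (B : groupType) (s : X -> B) :
  (forall v w, rel v w -> eval_word s v = eval_word s w) ->
  forall v w, pres_eqv v w -> eval_word s v = eval_word s w.
Proof.
move=> srel v w; elim=> {v w} [v w /srel//|x e|v v' w w' _ + _|//|//|u v w _ -> _ //].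
  rewrite /eval_word !big_cons big_nil mulg1 /eval_letter.
  by case: e; rewrite /= ?mulVg ?mulgV.
by rewrite /eval_word !big_cat => -> ->.
Qed.

Lemma pres_lift (B : groupType) (s : X -> B) :
  (forall v w, rel v w -> eval_word s v = eval_word s w) ->
  exists phi : {multiplicative presented -> B}, forall x, phi (pres_gen x) = s x.
Proof.
move=> /pres_eqv_eval srel; pose f (a : presented) := eval_word s (pres_repr a).
have fE w : f (pres_class w) = eval_word s w by exact: srel (pres_classK w).
have fM a b : f (a * b) = f a * f b by rewrite [LHS]fE /eval_word big_cat.
pose fm := isMultiplicative.Build presented B f fM.
pose phi : {multiplicative presented -> B} := HB.pack f fm.
exists phi => x; rewrite [LHS]fE /eval_word big_seq1 //.
Qed.

End Presentation.

Section HNN.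
Context {A : groupType} (H : set A) (alpha : A -> A).

(* The group A is presented by its multiplication table on the generators
   [Some a]; the generator [None] is the stable letter. *)
Inductive hnn_rel : word (option A) -> word (option A) -> Prop :=
| hnn_table a b :
    hnn_rel [:: (Some a, false); (Some b, false)] [:: (Some (a * b), false)]
| hnn_conj h : H h ->
    hnn_rel [:: (None, false); (Some h, false); (None, true)]
            [:: (Some (alpha h), false)].

Definition hnn := presented hnn_rel.
HB.instance Definition _ := Group.on hnn.

Definition hnn_base (a : A) : hnn := pres_gen hnn_rel (Some a).
Definition hnn_stable : hnn := pres_gen hnn_rel None.

Fact hnn_baseM a b : hnn_base (a * b) = hnn_base a * hnn_base b.
Proof.
rewrite /hnn_base /pres_gen -[RHS]pres_genM.
by apply/pres_classP/pres_sym/pres_rel/hnn_table.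
Qed.

Lemma hnn_stableJ h : H h ->
  hnn_stable * hnn_base h * hnn_stable^-1 = hnn_base (alpha h).
Proof.
move=> Hh; pose w : word (option A) :=
  [:: (None, false)] ++ [:: (Some h, false)] ++ [:: (None, true)].
transitivity (pres_class hnn_rel w); first by rewrite !pres_genM pres_genV mulgA.
by apply/pres_classP; apply: pres_rel; exact: (hnn_conj Hh).
Qed.

End HNN.

(* Only the restriction of [alpha] to [H] matters. *)
Definition embedding_on (A : groupType) (H : set A) (alpha : A -> A) :=
  {in H &, {morph alpha : x y / x * y}} /\ {in H &, injective alpha}.

(* [iota] identifies A with a subgroup of G; its injectivity need not be
   required, since A embeds in the HNN-extension. *)
Definition is_hnn_extension (A G : groupType) (iota : {multiplicative A -> G})
    (g : G) (H : set A) (alpha : A -> A) :=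
  exists phi : {multiplicative hnn H alpha -> G},
    [/\ forall a, phi (hnn_base H alpha a) = iota a,
        phi (hnn_stable H alpha) = g & bijective phi].

(* Main.v *)
(* Since H is finitely generated and F is generated by x0 and x1, there is an N
   such that g_n h g_n^-1 = alpha(h) for all h in H and n >= N. Put f = g_N and
   t = f^-1 g. Then t commutes with H in G, and its approximations
   c_n = f^-1 g_n lie in the centralizer of H in F.

   Suppose first that there are r and a, b in F outside H with a supported on
   [0, r] and b on [r, 1]. If c_n(r) <= r then c_n a c_n^-1 commutes with b, and
   otherwise c_n^-1 a c_n does. Hence one of [t a t^-1, b] and [t^-1 a t, b] is
   trivial in G, whereas both are nontrivial in the HNN-extension, as shown by
   an action. If there are no such r, a, b, then H contains enough bump
   functions for its centralizer to be trivial. Then c_n = 1 for large n, so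
   t = 1 in G, which also fails in the HNN-extension. *)
Require Import Defs.
From mathcomp Require Import all_boot all_order all_algebra.
From mathcomp Require Import zify lra ring.
From mathcomp Require Import all_classical all_reals all_analysis.

Set Implicit Arguments.
Unset Strict Implicit.
Unset Printing Implicit Defensive.

Import Order.TTheory GRing.Theory Num.Theory.
Local Open Scope classical_set_scope.
Local Open Scope ring_scope.

(** * Elementary properties of the elements of F and their local affine form *)

Section ThompsonElements.
Context {R : realType}.
Implicit Types (f g h : thompson R) (x y : R).

Lemma thompsonM f g x : (f * g)%g x = f (g x). Proof. by []. Qed.

Lemma thompsonK f x : (f^-1)%g (f x) = x.
Proof. by rewrite -thompsonM mulVg. Qed.

Lemma thompsonVK f x : f ((f^-1)%g x) = x.
Proof. by rewrite -thompsonM mulgV. Qed.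

Lemma thompson_ext f g : (forall x, f x = g x) -> f = g.
Proof. by move=> fg; apply: val_inj; apply/funext. Qed.

Lemma thompson_out f x : ~~ (0 <= x <= 1) -> f x = x.
Proof. by have [g [[_ _ _ + _] _]] := thompsonP f; apply. Qed.

Lemma thompson_le f : {mono f : x y / x <= y}.
Proof. by have [g [[_ _ + _ _] _]] := thompsonP f. Qed.

Lemma thompson_lt f : {mono f : x y / x < y}.
Proof. exact/leW_mono/thompson_le. Qed.

Lemma thompson_inj f : injective f.
Proof. exact: can_inj (thompsonK f). Qed.

Lemma thompson_0 f : f 0 = 0.
Proof. by have [g [[_ _ _ _ +] _]] := thompsonP f. Qed.

Lemma thompson_1 f : f 1 = 1.
Proof. by have [g [_ [+ _]]] := thompsonP f. Qed.

Lemma thompson_dyadic_pl f : dyadic_pl f.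
Proof. by have [g [_ [_ +]]] := thompsonP f. Qed.

(** Finitely many break points leave a last affine piece, whose constant is fixed by [f 1 = 1]; thus
    the germ at 1 is determined by the exponent [k]. *)
Lemma thompson_affine_at_1 f : exists (k : int) (r : R),
  [/\ 0 < r, r < 1 & forall x, r <= x <= 1 -> f x = 1 - 2 ^ k * (1 - x)].
Proof.
have [s _ sf] := thompson_dyadic_pl f.
have [r [r0 r1 rs]] : exists r : R, [/\ 0 < r, r < 1 &
    forall c, c \in s -> ~~ (r < c < 1)].
  elim: {sf} s => [|c s [r [r0 r1 rs]]]; first by exists (1 / 2); split=> //; lra.
  case: (leP c r) => cr.
    exists r; split=> // d; rewrite inE => /predU1P[->|/rs//].
    by rewrite ltNge cr.
  case: (ltP c 1) => c1; last first.
    exists r; split=> // d; rewrite inE => /predU1P[->|/rs//].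
    by rewrite [c < 1]ltNge c1 andbF.
  exists c; split=> //; first exact: lt_trans cr.
  move=> d; rewrite inE => /predU1P[->|/rs]; first by rewrite ltxx.
  by apply: contra => /andP[cd ->]; rewrite andbT (lt_trans cr).
have [k [c fE]] := sf r 1 (ltW r0) r1 (lexx 1) rs.
exists k, r; split=> // x xr.
have := fE 1; rewrite lexx (ltW r1) thompson_1 => /(_ isT) f1.
by rewrite fE// [X in X - _]f1; ring.
Qed.

Lemma thompson_affine_on_grid f : exists m : nat, forall j : nat,
  (j.+1%:R / 2 ^+ m.+1 <= 1 :> R) ->
  exists (k : int) (c : R), forall x,
    j%:R / 2 ^+ m.+1 <= x <= j.+1%:R / 2 ^+ m.+1 -> f x = 2 ^ k * x + c.
Proof.
have [s ds sf] := thompson_dyadic_pl f.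
have [m ms] : exists m : nat, forall c, c \in s -> exists a : int, c = a%:~R / 2 ^+ m.+1.
  elim: s ds {sf} => [|c s IH] ds; first by exists 0%N.
  have [|m ms] := IH; first by move=> x xs; apply: ds; rewrite inE xs orbT.
  have [a [n cE]] := ds c (mem_head _ _).
  have two0 k : (2 ^+ k : R) != 0 by rewrite expf_neq0.
  exists (m + n)%N => d; rewrite inE => /predU1P[->|/ms[b ->]].
    by exists (a * 2 ^+ m.+1); rewrite cE intrM rmorphXn/= -addSn exprD; field; rewrite !two0.
  by exists (b * 2 ^+ n); rewrite intrM rmorphXn/= -addSn exprD; field; rewrite !two0.
exists m => j j1; have m0 : 0 < (2 ^+ m.+1 : R) by rewrite exprn_gt0.
apply: sf => //.
  by rewrite ltr_pM2r ?invr_gt0// ltr_nat.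
move=> c /ms[a ->]; rewrite !ltr_pM2r ?invr_gt0// !pmulrn !ltr_int.
by apply/negP => /andP[? ?]; lia.
Qed.

End ThompsonElements.

(** * Generation of Thompson's group by [x0] and [x1] *)

Section Ray.
Context {R : realType}.
Implicit Types (x y q : R) (i j : nat) (L : seq nat).

(* The increasing map [0, oo) -> [0, 1) sending [n, n + 1] affinely onto
   [1 - 2^-n, 1 - 2^-(n+1)]. In this coordinate the inverses of [x0] and [x1]
   stretch one unit interval by 2 and translate everything beyond it. *)
Definition ray y : R :=
  1 - (2 - (y - (Num.trunc y)%:R)) / 2 ^+ (Num.trunc y).+1.

Lemma ray01 y : 0 <= y <= 1 -> ray y = y / 2.
Proof.
move=> /andP[y0]; rewrite le_eqVlt => /predU1P[->|y1].
  by rewrite /ray truncn1; field.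
by rewrite /ray (_ : Num.trunc y = 0%N) ?(@truncn_def _ _ 0) ?y0//; field.
Qed.

Lemma rayS y : 0 <= y -> ray (y + 1) = (1 + ray y) / 2.
Proof.
move=> y0; rewrite /ray.
have /andP[t1 t2] := truncn_itv y0.
rewrite (@truncn_def _ (y + 1) (Num.trunc y).+1); last first.
  by rewrite -(natr1 (Num.trunc y)) lerD2r t1 -natr1 ltrD2r.
rewrite [in RHS]mulrC [in LHS]exprS -natr1; field.
by rewrite expf_neq0.
Qed.

Lemma le1B_pow2 x : x < 1 -> exists n, x <= 1 - 2 ^- n.+1.
Proof.
move=> x1; have e0 : 0 < 1 - x by lra.
have [n nP] : exists n : nat, (1 - x)^-1 < n%:R.
  by exists (Num.trunc (1 - x)^-1).+1; exact: truncnS_gt.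
exists n; suff : 2 ^- n.+1 <= 1 - x by lra.
rewrite invf_ple ?posrE ?exprn_gt0//; apply: le_trans (ltW nP) _.
by rewrite -natrX ler_nat (leq_trans (ltnW (ltn_expl n (ltnSn 1))))// leq_exp2l.
Qed.

Lemma ray_surj x : 0 <= x < 1 -> exists2 y, 0 <= y & ray y = x.
Proof.
move=> /andP[x0 x1]; have [n xn] := le1B_pow2 x1.
elim: n x x0 {x1} xn => [|n IH] x x0.
  by rewrite expr1 => xn; exists (2 * x); rewrite ?ray01; lra.
have [x2 _|x2 xn] := leP x (1 / 2); first by exists (2 * x); rewrite ?ray01; lra.
have [||y y0 yE] := IH (2 * x - 1); [lra| |].
  by move: xn; rewrite exprS invfM; lra.
by exists (y + 1); rewrite ?rayS// ?yE; lra.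
Qed.

(** In the coordinate [ray], [stretch i 2] is the inverse of the generator x_i of the infinite
    presentation of F, where x_(i+1) = x_0^-1 x_i x_0 for i >= 1. *)
Definition stretch i q y : R :=
  if y <= i%:R then y else if y <= i.+1%:R then i%:R + q * (y - i%:R)
  else y + q - 1.

Variant stretch_spec i q y : R -> Prop :=
| Stretch1 of y <= i%:R : stretch_spec i q y y
| Stretch2 of i%:R <= y & y <= i%:R + 1 :
    stretch_spec i q y (i%:R + q * (y - i%:R))
| Stretch3 of i%:R + 1 <= y : stretch_spec i q y (y + q - 1).

Lemma stretchP i q y : stretch_spec i q y (stretch i q y).
Proof.
rewrite /stretch -natr1.
case: (leP y i%:R) => [|/ltW] yi; first by constructor.
by case: (leP y (i%:R + 1)) => [|/ltW] yi1; constructor.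
Qed.

Lemma stretchE1 i q y : y <= i%:R -> stretch i q y = y.
Proof. by rewrite /stretch => ->. Qed.

Lemma stretchE2 i q y : i%:R <= y <= i%:R + 1 ->
  stretch i q y = i%:R + q * (y - i%:R).
Proof.
move=> /andP[? ?]; case: stretchP => // ?; first by rewrite (_ : y = i%:R); lra.
by rewrite (_ : y = i%:R + 1); lra.
Qed.

Lemma stretchE3 i q y : i%:R + 1 <= y -> stretch i q y = y + q - 1.
Proof.
move=> ?; case: stretchP => // [?|? ?]; first by lra.
by rewrite (_ : y = i%:R + 1); lra.
Qed.

Lemma stretch_ge0 i q y : 0 <= q -> 0 <= y -> 0 <= stretch i q y.
Proof.
move=> q0 y0; have i0 : 0 <= i%:R :> R by [].
case: stretchP => // [? ?|?]; last by lra.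
by rewrite addr_ge0// mulr_ge0//; lra.
Qed.

Lemma stretch1 i y : stretch i 1 y = y.
Proof. by case: stretchP => *; lra. Qed.

(** Doubling turns the two halves of [i, i+1] into unit intervals, and each is then stretched by
    [q]. The right one comes first, before stretching the left one displaces it. *)
Lemma stretch_double i q y : 1 <= q ->
  stretch i (2 * q) y = stretch i q (stretch i.+1 q (stretch i 2 y)).
Proof.
move=> q1; case: (stretchP i 2 y) => [yi|yi yi1|yi1].
- by rewrite (@stretchE1 i.+1) ?stretchE1//; rewrite -natr1; lra.
- have [yh|yh] := leP y (i%:R + 1 / 2).
    rewrite (@stretchE1 i.+1); last by rewrite -natr1; lra.
    by rewrite !stretchE2 ?yi//; [ring|apply/andP; split; lra].
  rewrite (@stretchE2 i.+1) -natr1; last by apply/andP; split; lra.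
  rewrite stretchE2 ?yi//.
  have p0 : 0 <= q * (i%:R + 2 * (y - i%:R) - (i%:R + 1)) by rewrite mulr_ge0//; lra.
  by rewrite stretchE3; [ring|lra].
- rewrite (@stretchE3 i.+1) -natr1; last by lra.
  by rewrite !stretchE3//; lra.
Qed.

(** Beyond 1, [stretch 0 2] is the translation by 1, so it conjugates the stretch of one interval
    into that of the next. *)
Lemma stretch0S i q y : (0 < i)%N -> 0 <= y -> 0 <= q ->
  stretch 0 2 (stretch i q y) = stretch i.+1 q (stretch 0 2 y).
Proof.
move=> i0 y0 q0; have i1 : 1 <= i%:R :> R by rewrite ler1n.
have [y1|y1] := leP y 1.
  rewrite (@stretchE2 0 _ y) ?add0r ?y0// subr0.
  rewrite (@stretchE1 i) ?(le_trans y1 i1)// stretchE2 ?add0r ?y0// subr0.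
  by rewrite stretchE1// -natr1; lra.
rewrite (@stretchE3 0 2 y) ?add0r 1?ltW//.
case: (stretchP i) => [yi|yi yi1|yi1].
- by rewrite stretchE3 ?add0r 1?ltW// stretchE1 -?natr1; lra.
- rewrite stretchE3 ?add0r; last by nra.
  by rewrite (@stretchE2 i.+1) -natr1; [ring|apply/andP; split; lra].
- rewrite stretchE3 ?add0r; last by lra.
  by rewrite (@stretchE3 i.+1) -?natr1; lra.
Qed.

(** [L] lists the exponents of the slopes on successive unit intervals from [i] on. Later intervals
    are stretched first, while they are still in place. *)
Fixpoint stretches i L y : R :=
  if L is l :: L' then stretch i (2 ^+ l) (stretches i.+1 L' y) else y.

Lemma stretches_le i L y : y <= i%:R -> stretches i L y = y.
Proof.
elim: L i => //= l L IH i yi; rewrite IH ?(le_trans yi) ?ler_nat//.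
by rewrite /stretch yi.
Qed.

Lemma stretches_piece i L j y : (j < size L)%N ->
  i%:R + j%:R <= y <= i%:R + j%:R + 1 ->
  stretches i L y = i%:R + \sum_(l <- take j L) 2 ^+ l
                    + 2 ^+ nth 0%N L j * (y - i%:R - j%:R).
Proof.
elim: L i j => //= l L IH i [|j] jL /andP[jy yj] /=.
  rewrite addr0 in jy yj.
  by rewrite stretches_le -?natr1// stretchE2 ?jy// big_nil subr0 addr0.
rewrite -natr1 in jy yj; rewrite (IH _ j)//; last first.
  by rewrite -natr1; apply/andP; split; lra.
rewrite -natr1.
have S0 : 0 <= \sum_(l <- take j L) 2 ^+ l :> R by apply: sumr_ge0.
have p0 : 0 <= 2 ^+ nth 0%N L j * (y - (i%:R + 1) - j%:R) by rewrite mulr_ge0//; lra.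
rewrite stretchE3; last by lra.
by rewrite big_cons; ring.
Qed.

Lemma stretches_ge i L y : i%:R + (size L)%:R <= y ->
  stretches i L y = y + \sum_(l <- L) 2 ^+ l - (size L)%:R.
Proof.
elim: L i => /= [|l L IH] i; first by rewrite big_nil; lra.
rewrite -(natr1 (size L)) => yi; rewrite IH; last by rewrite -natr1; lra.
have : (size L)%:R <= \sum_(l <- L) 2 ^+ l :> R.
  rewrite -sum1_size natr_sum; apply: ler_sum => k _.
  by rewrite exprn_ege1// ler1n.
have : 0 <= (size L)%:R :> R by [].
by move=> ? ?; rewrite big_cons stretchE3; lra.
Qed.

End Ray.

Section Generation.
Context {R : realType}.
Implicit Types (f g k : thompson R) (x y q : R) (i j : nat) (L : seq nat).

Lemma x0E1 x : 0 <= x <= 1 / 2 -> (x0 : thompson R) x = x / 2.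
Proof.
move=> /andP[? x2]; rewrite /= /x0_fun x2 ifF//.
by apply/negbF/andP; split; lra.
Qed.

Lemma x0E2 x : 1 / 2 <= x <= 3 / 4 -> (x0 : thompson R) x = x - 1 / 4.
Proof.
move=> /andP[x1 x2]; rewrite /= /x0_fun x2 ifF; last by apply/negbF/andP; split; lra.
by case: leP => // ?; lra.
Qed.

Lemma x0E3 x : 3 / 4 <= x <= 1 -> (x0 : thompson R) x = 2 * x - 1.
Proof.
move=> /andP[x1 x2]; rewrite /= /x0_fun ifF; last by apply/negbF/andP; split; lra.
by case: leP => ?; [lra|case: leP => ?; lra].
Qed.

Lemma x1E1 x : 0 <= x <= 1 / 2 -> (x1 : thompson R) x = x.
Proof.
by move=> /andP[? x2]; rewrite /= /x1_fun x2; case: ifP.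
Qed.

Lemma x1_half x : 0 <= x <= 1 ->
  (x1 : thompson R) ((1 + x) / 2) = (1 + (x0 : thompson R) x) / 2.
Proof.
move=> /[dup] xI /andP[? ?]; rewrite /= /x1_fun /x0_fun xI /=.
rewrite ifF; last by apply/negbF/andP; split; lra.
by do ![case: leP => ?; try lra].
Qed.

Lemma ray_itv y : 0 <= y -> 0 <= ray y < 1.
Proof.
move=> /truncn_itv/andP[]; rewrite /ray -(natr1 (Num.trunc y)) exprS.
have : 1 <= 2 ^+ Num.trunc y :> R by rewrite exprn_ege1// ler1n.
move: (Num.trunc y)%:R (2 ^+ _) => t p p1 ty yt.
have p0 : 0 < p^-1 by rewrite invr_gt0; lra.
have p1' : p^-1 <= 1 by rewrite invf_le1; lra.
by rewrite invfM; apply/andP; split; nra.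
Qed.

Lemma x0_ray y : 0 <= y -> (x0^-1)%g (ray y) = ray (stretch 0 2 y).
Proof.
move=> y0; apply: (@thompson_inj _ x0); rewrite thompsonVK; symmetry.
have [y1|/ltW y1] := leP y 1.
  rewrite stretchE2 ?add0r ?y0// subr0 (@ray01 _ y) ?y0//.
  have [y2|/ltW y2] := leP y (1 / 2).
    by rewrite ray01 ?x0E1; lra.
  rewrite -(subrK 1 (2 * y)) rayS ?ray01 ?x0E2; lra.
rewrite stretchE3 ?add0r// (_ : y + 2 - 1 = y + 1); last by lra.
rewrite rayS// x0E3; first by field.
have -> : ray y = (1 + ray (y - 1)) / 2 by rewrite -rayS ?subrK//; lra.
by have /andP[? ?] : 0 <= ray (y - 1) < 1 by [apply: ray_itv; lra]; lra.
Qed.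

Lemma x1_ray y : 0 <= y -> (x1^-1)%g (ray y) = ray (stretch 1 2 y).
Proof.
move=> y0; apply: (@thompson_inj _ x1); rewrite thompsonVK; symmetry.
have [y1|/ltW y1] := leP y 1.
  by rewrite stretchE1// x1E1 ray01 ?y0//; lra.
have -> : stretch 1 2 y = stretch 0 2 (y - 1) + 1.
  case: (stretchP 0) => [y2|y2 y3|y2].
  - by rewrite (_ : y = 1) ?stretchE1//; lra.
  - by rewrite stretchE2; lra.
  - by rewrite stretchE3; lra.
have y10 : 0 <= y - 1 by lra.
have s0 : 0 <= stretch 0 2 (y - 1) :> R by apply: stretch_ge0.
rewrite rayS// x1_half; last by have := ray_itv s0; lra.
by rewrite -x0_ray// thompsonVK -rayS// subrK.
Qed.

Variable K : set (thompson R).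
Hypotheses (K_group : subgroup K) (K_x0 : K x0) (K_x1 : K x1).

Let K_mul f g : K f -> K g -> K (f * g)%g.
Proof. by move=> /mem_set Kf /mem_set Kg; apply/set_mem; exact: (group_closedM K_group). Qed.

Let K_inv f : K f -> K (f^-1)%g.
Proof. by move=> /mem_set Kf; apply/set_mem; exact: (group_closedV K_group). Qed.

(** Since [ray] maps [0, oo) onto [0, 1) and an element of F is the identity elsewhere, [e]
    determines [k]. Membership in [K] is established through such maps. *)
Definition ray_conj k (e : R -> R) := forall y, 0 <= y -> 0 <= e y /\ k (ray y) = ray (e y).

Definition realized (e : R -> R) := exists2 k, K k & ray_conj k e.

Lemma realizedM e1 e2 : realized e1 -> realized e2 -> realized (e1 \o e2).
Proof.
move=> [k1 Kk1 H1] [k2 Kk2 H2]; exists (k1 * k2)%g; first exact: K_mul.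
move=> y y0; have [e2y k2E] := H2 y y0; have [e1y k1E] := H1 _ e2y.
by rewrite thompsonM k2E k1E.
Qed.

Lemma realized_eq e1 e2 : (forall y, 0 <= y -> e1 y = e2 y) ->
  realized e1 -> realized e2.
Proof. by move=> e12 [k Kk H]; exists k => // y y0; rewrite -e12//; exact: H. Qed.

Lemma realized_id : realized id.
Proof. by exists (x0 * x0^-1)%g; [exact/K_mul/K_inv|rewrite mulgV]. Qed.

(** The cases 0 and 1 come from [x0] and [x1]; conjugation by [x0] then raises [i], by
    [stretch0S]. *)
Lemma realized_stretch2 i : realized (stretch i 2).
Proof.
have x0P : ray_conj (x0^-1)%g (stretch 0 2).
  by move=> y y0; split; [exact: stretch_ge0|exact: x0_ray].
case: i => [|i]; first by exists (x0^-1)%g; [exact: K_inv|].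
elim: i => [|i [k Kk H]].
  exists (x1^-1)%g; first exact: K_inv.
  by move=> y y0; split; [exact: stretch_ge0|exact: x1_ray].
exists (x0^-1 * k * x0)%g; first by do 2![apply: K_mul => //]; exact: K_inv.
move=> y y0; split; first exact: stretch_ge0.
have [z z0 <-] : exists2 z, 0 <= z & stretch 0 2 z = y.
  have [y1|/ltW y1] := leP y 2; [exists (y / 2)|exists (y - 1)]; try lra.
    by rewrite stretchE2; lra.
  by rewrite stretchE3; lra.
rewrite !thompsonM -x0_ray// thompsonVK; have [kz0 ->] := H z z0.
by rewrite x0_ray// stretch0S.
Qed.

Lemma realized_stretch i n : realized (stretch i (2 ^+ n)).
Proof.
elim: n i => [|n IH] i.
  by apply: realized_eq realized_id => y _; rewrite expr0 stretch1.
apply: realized_eq (realizedM (IH i) (realizedM (IH i.+1) (realized_stretch2 i))).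
by move=> y _; rewrite exprS stretch_double ?exprn_ege1 ?ler1n.
Qed.

Lemma realized_stretches i L : realized (stretches i L).
Proof.
elim: L i => [|l L IH] i; first exact: realized_id.
exact: realizedM (realized_stretch i l) (IH i.+1).
Qed.


(** This is [f] in the coordinate [ray] if [f] is supported on [0, 1/2], since [ray] halves the
    points of [0, 1]. *)
Let half_map f y := if y <= 1 then 2 * f (y / 2) else y.

Lemma half_map_ray f y : (forall x, 1 / 2 <= x -> f x = x) -> 0 <= y ->
  0 <= half_map f y /\ f (ray y) = ray (half_map f y).
Proof.
move=> fid y0; rewrite /half_map; have [y1|/ltW y1] := leP y 1.
  have f0 : 0 <= f (y / 2) by rewrite -[0](thompson_0 f) thompson_le; lra.
  have f1 : f (y / 2) <= 1 / 2 by rewrite -[leRHS](fid (1 / 2)) ?thompson_le; lra.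
  by split; [lra|rewrite (@ray01 _ y) ?y0// ray01; lra].
split=> //; rewrite fid//; have -> : ray y = (1 + ray (y - 1)) / 2.
  by rewrite -rayS ?subrK//; lra.
by have /andP[? ?] : 0 <= ray (y - 1) < 1 by [apply: ray_itv; lra]; lra.
Qed.

(* In the coordinate [ray], [f] is supported on [0, 1] and maps a grid of mesh
   2^-m to intervals of lengths 2^(k_j - m). Stretching [0, 1] by 2^m in the
   source and by a large 2^M in the target turns it into a product of stretches. *)
Lemma half_map_stretches f : (forall x, 1 / 2 <= x -> f x = x) ->
  exists m M L, forall y, 0 <= y ->
    stretch 0 (2 ^+ M) (half_map f y) = stretches 0 L (stretch 0 (2 ^+ m) y).
Proof.
move=> fid.
have [m [k [c fE]]] : exists (m : nat) (k : nat -> int) (c : nat -> R), forall j x,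
    (j < 2 ^ m)%N -> j%:R / 2 ^+ m.+1 <= x <= j.+1%:R / 2 ^+ m.+1 ->
    f x = 2 ^ k j * x + c j.
  have [n fn] := thompson_affine_on_grid f.
  have /choice[k kE] : forall j : nat, exists kc : int * R,
      (j < 2 ^ n)%N -> forall x, j%:R / 2 ^+ n.+1 <= x <= j.+1%:R / 2 ^+ n.+1 ->
      f x = 2 ^ kc.1 * x + kc.2.
    move=> j; have [jn|jn] := ltnP j (2 ^ n); last by exists (0, 0).
    have [|l [d fE]] := fn j; last by exists (l, d).
    rewrite ler_pdivrMr ?exprn_gt0// mul1r -natrX ler_nat.
    by rewrite (leq_trans jn)// leq_exp2l.
  by exists n, (fun j => (k j).1), (fun j => (k j).2) => j x jn; exact: kE.
(* Large enough for all the exponents [M - m + k j] to be nonnegative. *)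
pose M := (m + \sum_(j < 2 ^ m) `|k j|)%N.
pose l j := `|((M - m)%N%:Z + k j)%R|%N.
have two_l j : (j < 2 ^ m)%N -> 2 ^+ l j = 2 ^+ M / 2 ^+ m * 2 ^ k j :> R.
  move=> jm; have kM : (`|k j| <= M - m)%N.
    by rewrite /M addKn (bigD1 (Ordinal jm))//= leq_addr.
  rewrite -[2 ^+ l j]/((2 : R) ^ (l j)%:Z) /l gez0_abs; last by lia.
  rewrite expfzDr ?pnatr_eq0// -exprnP; congr (_ * _).
  have <- : (M - m + m = M)%N by rewrite subnK ?leq_addr.
  by rewrite addnK exprD mulfK ?expf_neq0.
pose L := mkseq l (2 ^ m).
have sL : size L = (2 ^ m)%N by rewrite size_mkseq.
have two0 n : 0 < 2 ^+ n :> R by rewrite exprn_gt0.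
(* Grid points must match: the first [j] factors add up to the rescaled value of [f] at the [j]-th
   grid point. *)
have sumE j : (j <= 2 ^ m)%N ->
    \sum_(i <- take j L) 2 ^+ i = 2 ^+ M.+1 * f (j%:R / 2 ^+ m.+1).
  elim: j => [_|j IH jm]; first by rewrite take0 big_nil mul0r thompson_0 mulr0.
  rewrite (take_nth 0%N) ?sL// big_rcons/= IH 1?ltnW// nth_mkseq//.
  rewrite two_l// !(fE j)//; first last.
  - by rewrite lexx ler_pM2r ?invr_gt0// ler_nat leqnSn.
  - by rewrite lexx andbT ler_pM2r ?invr_gt0// ler_nat leqnSn.
  rewrite -(natr1 j) !exprS; field.
  by rewrite gt_eqF.
(* Since [f] fixes 1/2, both sides translate the points beyond 1 by the same amount. *)
have sumT : \sum_(i <- L) 2 ^+ i = 2 ^+ M :> R.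
  rewrite -{1}[L](@take_size) sL sumE// natrX !exprS.
  have -> : 2 ^+ m / (2 * 2 ^+ m) = 1 / 2 :> R by field; rewrite gt_eqF.
  by rewrite fid//; field.
exists m, M, L => y y0; rewrite /half_map.
have [y1|/ltW y1] := leP y 1; last first.
  rewrite !stretchE3 ?add0r// stretches_ge ?sL ?add0r ?natrX ?sumT; first by ring.
  by have := two0 m; lra.
rewrite [in RHS]stretchE2 ?add0r ?y0// subr0.
have -> : stretch 0 (2 ^+ M) (2 * f (y / 2)) = 2 ^+ M.+1 * f (y / 2).
  rewrite stretchE2 ?add0r ?subr0 ?exprS; first by ring.
  apply/andP; split.
    by rewrite mulr_ge0// -[0](thompson_0 f) thompson_le; lra.
  by have : f (y / 2) <= f (1 / 2); [rewrite thompson_le; lra|rewrite (fid (1 / 2))//; lra].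
have z0 : 0 <= 2 ^+ m * y by rewrite mulr_ge0// ltW.
pose j := Num.trunc (2 ^+ m * y).
have /andP[jz zj] : j%:R <= 2 ^+ m * y < j.+1%:R by exact: truncn_itv.
have [jm|jm] := ltnP j (2 ^ m).
  rewrite (@stretches_piece _ _ _ j) ?sL// ?add0r ?jz ?natr1 ?(ltW zj)//.
  rewrite sumE 1?ltnW// nth_mkseq// two_l// subr0 !(fE j)//; first last.
  - rewrite ler_pdivrMr// ler_pdivlMr// exprS.
    by apply/andP; split; lra.
  - by rewrite lexx ler_pM2r ?invr_gt0// ler_nat leqnSn.
  by rewrite !exprS; field; rewrite gt_eqF.
have y1E : y = 1.
  apply/le_anti; rewrite y1 /= -(ler_pM2l (two0 m)) mulr1 (le_trans _ jz)//.
  by rewrite -natrX ler_nat.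
rewrite y1E mulr1 stretches_ge ?sL ?add0r ?natrX// sumT fid// exprS.
by field.
Qed.


Lemma thompson_half_in f : (forall x, 1 / 2 <= x -> f x = x) -> K f.
Proof.
move=> fid; have [m [M [L fE]]] := half_map_stretches fid.
have [k1 Kk1 H1] := realized_stretch 0 M.
have [k2 Kk2 H2] := realizedM (realized_stretches 0 L) (realized_stretch 0 m).
suff -> : f = (k1^-1 * k2)%g by exact/K_mul/Kk2/K_inv.
apply: thompson_ext => x; have [/ray_surj[y y0 <-]|xI] := boolP (0 <= x < 1).
  apply: (@thompson_inj _ k1); rewrite thompsonM thompsonVK.
  have [hy0 ->] := half_map_ray fid y0.
  by have [_ ->] := H1 _ hy0; have [_ ->] := H2 _ y0; rewrite fE.
have [->|x1] := eqVneq x 1; first by rewrite !thompson_1.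
by rewrite !thompson_out// [x <= 1]le_eqVlt (negbTE x1).
Qed.

(** Near 1, [x0] doubles the distance to 1, so conjugation by it doubles the neighbourhood on which
    [f] is the identity, until this is [1/2, 1]. *)
Lemma thompson_near1_in f n :
  (forall x, 1 - 2 ^- n.+1 <= x -> f x = x) -> K f.
Proof.
elim: n f => [|n IH] f fid.
  by apply: thompson_half_in => x xh; apply: fid; rewrite expr1; lra.
suff -> : f = (x0^-1 * (x0 * f * x0^-1) * x0)%g.
  apply: (K_mul _ K_x0); apply: K_mul; first exact: K_inv.
  apply: IH => x xn; rewrite !thompsonM fid ?thompsonVK//.
  have e0 : 0 < 2 ^- n.+1 :> R by rewrite invr_gt0 exprn_gt0.
  have e1 : 2 ^- n.+1 <= 1 / 2 :> R.
    rewrite exprS invfM div1r ler_piMr// invf_le1 ?exprn_gt0//.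
    by rewrite exprn_ege1// ler1n.
  rewrite -(thompson_le x0) thompsonVK (le_trans _ xn)// exprS invfM.
  by rewrite x0E3; lra.
by rewrite !mulgA mulVg mul1g -mulgA mulVg mulg1.
Qed.

Lemma germ_in n : exists2 k, K k & exists2 r : R, r < 1 &
  forall x, r <= x <= 1 -> k x = 1 - 2 ^+ n * (1 - x).
Proof.
elim: n => [|n [k Kk [r r1 kE]]].
  exists (x0 * x0^-1)%g; first exact/K_mul/K_inv.
  by rewrite mulgV; exists 0 => // x _; rewrite expr0 mul1r /=; ring.
exists (x0 * k)%g; first exact: K_mul.
have p0 : 0 < 2 ^+ n :> R by rewrite exprn_gt0.
exists (Num.max r (1 - (4 * 2 ^+ n)^-1)).
  by rewrite gt_max r1 ltrBlDr ltrDl invr_gt0; lra.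
move=> x; rewrite ge_max => /andP[/andP[rx hx] x1].
rewrite thompsonM kE ?rx// x0E3; first by rewrite exprS; ring.
have : 2 ^+ n * (1 - x) <= 1 / 4.
  rewrite mulrC -ler_pdivlMr// div1r -invfM; lra.
have : 0 <= 2 ^+ n * (1 - x) by rewrite mulr_ge0; lra.
by move=> ? ?; apply/andP; split; lra.
Qed.

(** The element with the inverse slope from [germ_in] cancels the germ of [f] at 1, which reduces to
    [thompson_near1_in]. *)
Let flat_germ_in f n (r : R) : r < 1 ->
  (forall x, r <= x <= 1 -> f x = 1 - (2 ^+ n)^-1 * (1 - x)) -> K f.
Proof.
move=> r1 fE; have [k Kk [s s1 kE]] := germ_in n.
have p0 : 0 < 2 ^+ n :> R by rewrite exprn_gt0.
(* Beyond [t] both formulas apply: that of [f] at [x], and that of [k] at [f x]. *)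
pose t := Num.max r ((f^-1)%g s).
have t1 : t < 1.
  by rewrite gt_max r1 -(thompson_1 (f^-1)%g) thompson_lt.
have [m tm] := le1B_pow2 t1.
suff : K (k * f)%g by move=> /(K_mul (K_inv Kk)); rewrite mulKg.
apply: (@thompson_near1_in _ m) => x mx.
have [x1|x1] := leP x 1; last by rewrite thompson_out// [x <= 1]leNgt x1 andbF.
have : t <= x by exact: le_trans mx.
rewrite ge_max => /andP[rx sx].
rewrite thompsonM kE.
  by rewrite fE ?rx//; field; rewrite gt_eqF.
by rewrite -[s](thompsonVK f) -[1](thompson_1 f) !thompson_le sx.
Qed.

Lemma thompson_in f : K f.
Proof.
have [[n|n] [r [r0 r1 fE]]] := thompson_affine_at_1 f; last first.
  exact: flat_germ_in r1 fE.
(* A slope 2^n at 1 with n >= 0 is turned into 2^-n by passing to the inverse. *)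
suff : K (f^-1)%g by move/K_inv; rewrite invgK.
have p0 : 0 < 2 ^+ n :> R by rewrite exprn_gt0.
apply: (@flat_germ_in _ n (f r)) => [|x /andP[rx x1]].
  by rewrite -(thompson_1 f) thompson_lt.
have yr : r <= (f^-1)%g x <= 1.
  by rewrite -(thompson_le f r) -(thompson_le f _ 1) thompsonVK thompson_1 rx.
rewrite -{2}(thompsonVK f x) (fE _ yr) -exprnP; field.
by rewrite gt_eqF.
Qed.

End Generation.

Lemma thompson_generated (R : realType) :
  generated [set` [:: x0; x1]] = [set: thompson R].
Proof.
apply/seteqP; split=> // f _ K [K_group sK].
by apply: thompson_in K_group _ _ f; apply: sK; rewrite /= !inE eqxx ?orbT.
Qed.

(** * Bump functions and centralizers *)

Section Bumps.
Context {R : realType}.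
Implicit Types (f g h : thompson R) (x y u v r a b c : R).

Section Rescale.
Variables (p : R) (n : nat).
Hypotheses (dp : dyadic p) (p0 : 0 <= p) (p1 : p + 2 ^- n <= 1).

Let e0 : 0 < 2 ^+ n :> R. Proof. by rewrite exprn_gt0. Qed.
Let e_neq0 : 2 ^+ n != 0 :> R. Proof. by rewrite gt_eqF. Qed.

Let scK x : 2 ^+ n * (p + x / 2 ^+ n - p) = x. Proof. by field. Qed.

(** The conjugate of [f] by the affine map of [0, 1] onto [p, p + 2^-n]. It is the identity outside
    this interval because [f] is the identity outside [0, 1]. *)
Definition rescale f x : R := p + f (2 ^+ n * (x - p)) / 2 ^+ n.

Let rescaleK f : cancel (rescale f) (rescale (f^-1)%g).
Proof.
by move=> x; rewrite /rescale scK thompsonK; field.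
Qed.

Lemma rescale_out f x : ~~ (p < x < p + 2 ^- n) -> rescale f x = x.
Proof.
move=> xI; rewrite /rescale; suff -> : f (2 ^+ n * (x - p)) = 2 ^+ n * (x - p) by field.
move: xI; rewrite negb_and -!leNgt => /orP[xp|px].
  move: xp; rewrite le_eqVlt => /predU1P[->|xp].
    by rewrite subrr mulr0 thompson_0.
  by rewrite thompson_out// [0 <= _]leNgt pmulr_rlt0// subr_lt0 xp.
move: px; rewrite le_eqVlt => /predU1P[<-|px].
  by rewrite -{1 2}(div1r (2 ^+ n)) scK thompson_1.
rewrite thompson_out// [_ <= 1]leNgt andbC mulrC -ltr_pdivrMr// mul1r.
by rewrite ltrBrDl px.
Qed.

Lemma rescale_funP f : thompson_fun (rescale f).
Proof.
apply/thompson_funP; exists (rescale (f^-1)%g); split; first split.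
- exact: rescaleK.
- by rewrite -{2}[f]invgK; exact: rescaleK.
- by move=> x y; rewrite lerD2l ler_pM2r ?invr_gt0// thompson_le ler_pM2l// lerD2r.
- move=> x xI; apply: rescale_out; apply: contra xI => /andP[px xp].
  by rewrite (le_trans p0 (ltW px)) (le_trans (ltW xp) p1).
- by rewrite rescale_out// negb_and -!leNgt p0.
split; first by rewrite rescale_out// negb_and -!leNgt p1 orbT.
have [s ds sf] := thompson_dyadic_pl f.
have de : dyadic (2 ^- n : R) by exists 1, n; rewrite div1r.
(* The end points 0 and 1 are included so that an interval without break points does not straddle an
   end of [p, p + 2^-n]. *)
exists [seq p + c / 2 ^+ n | c <- [:: 0, 1 & s]].
  move=> x /mapP[c cs ->]; apply: dyadicD => //; apply: dyadicM => //.
  move: cs; rewrite !inE => /or3P[/eqP->|/eqP->|/ds//]; first exact: dyadic0.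
  exact: (dyadic_int 1).
move=> a b a0 ab b1 av.
pose sc x := 2 ^+ n * (x - p).
have avs d : d \in [:: 0, 1 & s] -> ~~ (sc a < d < sc b).
  move=> /(map_f (fun c => p + c / 2 ^+ n))/av.
  by rewrite -ltrBlDl ltr_pdivlMr// mulrC -ltrBrDl ltr_pdivrMr// [_ * 2 ^+ n]mulrC.
have sc_le x y : (sc x <= sc y) = (x <= y) by rewrite ler_pM2l// lerD2r.
have idP : (forall x, a <= x <= b -> ~~ (p < x < p + 2 ^- n)) ->
    affine_pow2 (rescale f) a b.
  by move=> H; exists 0, 0 => x /H/rescale_out->; rewrite expr0z mul1r addr0.
have := avs 0; rewrite !inE eqxx => /(_ isT); rewrite negb_and -!leNgt => /orP[a'0|b'0]; last first.
  apply: idP => x /andP[_ xb]; rewrite negb_and -!leNgt.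
  by rewrite -subr_le0 -(pmulr_rle0 _ e0) (le_trans _ b'0) ?sc_le.
have := avs 1; rewrite !inE eqxx orbT => /(_ isT); rewrite negb_and -!leNgt => /orP[a'1|b'1].
  apply: idP => x /andP[ax _]; rewrite negb_and -!leNgt.
  by rewrite -lerBrDl -(ler_pM2l e0) mulfV// (le_trans a'1) ?orbT// sc_le.
have [|c cs|k [c fE]] := sf (sc a) (sc b) a'0 _ b'1.
- by rewrite ltr_pM2l// ltrD2r.
- by apply: avs; rewrite !inE cs !orbT.
exists k, (p - 2 ^ k * p + c / 2 ^+ n) => x /andP[ax xb].
by rewrite /rescale (fE (sc x)) ?sc_le ?ax// /sc; field.
Qed.

End Rescale.

Lemma thompson_bump u v : 0 <= u -> u < v -> v <= 1 -> exists h : thompson R,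
  (exists2 y, u < y < v & h y != y) /\ (forall x, ~~ (u < x < v) -> h x = x).
Proof.
move=> u0 uv v1.
have [n] : exists n, 1 - (v - u) / 2 <= 1 - 2 ^- n.+1 by apply: le1B_pow2; lra.
rewrite lerD2l lerN2 => nuv.
have e_gt0 : 0 < 2 ^- n.+1 :> R by rewrite invr_gt0 exprn_gt0.
have e0 : 0 < 2 ^+ n.+1 :> R by rewrite exprn_gt0.
(* The point [p] is the first multiple of 2^-(n+1) beyond [u]. As this mesh is at most half of
   [v - u], the copy of [x0] on [p, p + 2^-(n+1)] moves only points of (u, v). *)
pose t := Num.trunc (2 ^+ n.+1 * u).
pose p : R := t.+1%:R / 2 ^+ n.+1.
have /andP[tu ut] : t%:R <= 2 ^+ n.+1 * u < t.+1%:R.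
  by apply: truncn_itv; rewrite mulr_ge0// ltW.
have up : u < p by rewrite /p ltr_pdivlMr// mulrC.
have pu : p <= u + 2 ^- n.+1.
  by rewrite /p -natr1 mulrDl mul1r lerD2r ler_pdivrMr// mulrC.
have dp : dyadic p by exists t.+1%:Z, n.+1.
have p0 : 0 <= p by lra.
have p1 : p + 2 ^- n.+1 <= 1 by lra.
exists (thompson_of (rescale_funP dp p0 p1 x0)); split=> [|x xuv].
  exists (p + (1 / 2) / 2 ^+ n.+1) => /=.
    by apply/andP; split; lra.
  rewrite /rescale (_ : 2 ^+ n.+1 * _ = 1 / 2); last by field; rewrite gt_eqF.
  by rewrite x0E1; last lra; rewrite lt_eqF//; lra.
apply: rescale_out; apply: contra xuv => /andP[? ?].
by apply/andP; split; lra.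
Qed.

Lemma thompson_commute f g r : (forall x, r <= x -> f x = x) ->
  (forall x, x <= r -> g x = x) -> (f * g = g * f)%g.
Proof.
move=> fr gr; apply: thompson_ext => x; rewrite !thompsonM.
have [xr|/ltW rx] := leP x r.
  by rewrite (gr x)// gr// -(fr r)// thompson_le.
by rewrite (fr x)// fr// -(gr r)// thompson_le.
Qed.

End Bumps.

Section Separation.
Context {R : realType}.
Variable H : set (thompson R).
Implicit Types (a b c h : thompson R) (r x : R).

Definition separated := exists r a b, [/\ ~ H a, ~ H b,
  forall x, r <= x -> a x = x & forall x, x <= r -> b x = x].

(** If [d] centralizes [H] and [d x < x], then [d] maps the interval from [d x] to [x] off itself,
    so [H] contains no nontrivial element supported there. Bumps on its two halves then show that
    [H] is [separated]. *)
Lemma centralizer_trivial c : ~ separated ->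
  (forall h, H h -> c * h = h * c)%g -> c = 1%g.
Proof.
move=> nsep.
(* One inequality suffices, since it applies to both [c] and [c^-1]. *)
suff H1 d x : (forall h, H h -> d * h = h * d)%g -> x <= d x.
  move=> cH; apply: thompson_ext => x; apply/le_anti; rewrite H1// andbT.
  rewrite -(thompson_le (c^-1)%g) thompsonK; apply: H1 => h Hh.
  by apply: (mulgI c); rewrite mulVKg mulgA cH// mulgK.
move=> dH; rewrite leNgt; apply/negP => dx.
have [x0|x0] := ltP x 0.
  by move: dx; rewrite thompson_out ?ltxx// [0 <= x]leNgt x0.
have [x1|x1] := ltP 1 x.
  by move: dx; rewrite thompson_out ?ltxx// [x <= 1]leNgt x1 andbF.
have dx0 : 0 <= d x by rewrite -(thompson_0 d) thompson_le.
(* [d] carries [y] out of the support of [h], so [d (h y) = h (d y) = d y]. *)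
have no_bump h u v y : (forall z, ~~ (u < z < v) -> h z = z) -> d x <= u -> v <= x ->
    u < y < v -> h y != y -> ~ H h.
  move=> hout du vx /andP[uy yv] /eqP hy Hh; apply: hy.
  apply: (@thompson_inj _ d); rewrite -thompsonM dH// thompsonM hout//.
  rewrite negb_and -!leNgt (le_trans _ du)// ltW// thompson_lt.
  exact: lt_le_trans vx.
pose m := (d x + x) / 2.
have [||h1 [[y1 y1I h1y] h1out]] := @thompson_bump _ (d x) m dx0; rewrite /m; [lra|lra|].
have [|||h2 [[y2 y2I h2y] h2out]] := @thompson_bump _ m x; rewrite /m; [lra|lra|lra|].
apply: nsep; exists m, h1, h2; split.
- by apply: no_bump h1out _ _ y1I h1y => //; rewrite /m; lra.
- by apply: no_bump h2out _ _ y2I h2y => //; rewrite /m; lra.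
- by move=> z mz; apply: h1out; rewrite negb_and -!leNgt mz orbT.
- by move=> z mz; apply: h2out; rewrite negb_and -!leNgt mz.
Qed.

End Separation.

(** Conjugation by [c] moves the support of [a] to the left of [c r], hence still to the left of
    [r]. *)
Lemma thompson_conj_commute (R : realType) (a b c : thompson R) r :
  (forall x, r <= x -> a x = x) -> (forall x, x <= r -> b x = x) -> c r <= r ->
  (c * a * c^-1 * b = b * (c * a * c^-1))%g.
Proof.
move=> ar br cr; apply: (@thompson_commute _ _ _ r) => // x rx.
rewrite !thompsonM ar ?thompsonVK//.
by rewrite -(thompson_le c) thompsonVK (le_trans cr).
Qed.

Local Open Scope group_scope.
(** * Nontrivial elements of an HNN-extension *)

Section HNNAction.
Context {A : groupType} (H : set A) (alpha : A -> A) (f : A).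
Hypotheses (H_group : subgroup H) (f_conj : forall h, H h -> f * h * f^-1 = alpha h).

(* [set A * int] is a disjoint union of copies of the left [A]-set of subsets
   of [A]. [H] fixes the point [H] of every copy, so that any permutation of
   these points commutes with [H]. *)
Definition translate (a : A) (z : set A * int) : set A * int :=
  ([set x | z.1 (a^-1 * x)], z.2).

Definition copy_shift (d : int) (z : set A * int) : set A * int :=
  if `[< z.1 = H >] then (z.1, z.2 + d)%R else z.

Lemma translateM a b z : translate (a * b) z = translate a (translate b z).
Proof.
by congr (_, _); apply/seteqP; split=> x; rewrite /= invgM mulgA.
Qed.

Lemma translate1 z : translate 1 z = z.
Proof.
case: z => S d; congr (_, _); apply/seteqP; split=> x; rewrite /= invg1 mul1g//.
Qed.

Lemma translateK a : cancel (translate a) (translate a^-1).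
Proof. by move=> z; rewrite -translateM mulVg translate1. Qed.

Lemma translateVK a : cancel (translate a^-1) (translate a).
Proof. by move=> z; rewrite -translateM mulgV translate1. Qed.

Let HV u : H u -> H u^-1.
Proof. by move=> /mem_set Hu; apply/set_mem; exact: (group_closedV H_group). Qed.

Lemma translate_fix a z : z.1 = H -> (translate a z).1 = H <-> H a.
Proof.
move=> zH; rewrite /= zH.
have HM u v : H u -> H v -> H (u * v).
  by move=> /mem_set Hu /mem_set Hv; apply/set_mem; exact: (group_closedM H_group).
have H1 : H 1 by apply/set_mem; have [] := H_group.
split=> [E|Ha]; first by rewrite -E /= mulVg.
apply/seteqP; split=> x /= Hx; last exact/HM/Hx/HV.
by rewrite -[x](mulVKg a); exact: HM.
Qed.

Lemma shiftD d e z : copy_shift d (copy_shift e z) = copy_shift (d + e)%R z.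
Proof.
rewrite /copy_shift; have [zH|zH] := pselect (z.1 = H).
  by rewrite !(asboolT zH) /= ?(asboolT zH); congr (_, _); lia.
by rewrite !(asboolF zH) ?(asboolF zH).
Qed.

Lemma shift0 z : copy_shift 0 z = z.
Proof. by rewrite /copy_shift addr0; case: z => S d /=; case: ifP. Qed.

Lemma shift_translate d h z : H h -> copy_shift d (translate h z) = translate h (copy_shift d z).
Proof.
move=> Hh; rewrite /copy_shift.
have -> : `[< (translate h z).1 = H >] = `[< z.1 = H >].
  apply: asbool_equiv_eq; split=> zH; last exact: (translate_fix h zH).2.
  by rewrite -[z](translateK h); exact: (translate_fix h^-1 zH).2 (HV Hh).
by case: ifP.
Qed.

(** The stable letter is [f t], where [t] acts by [copy_shift 1]. *)
Definition act_letter (l : option A * bool) (z : set A * int) : set A * int :=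
  match l with
  | (Some a, e) => translate (if e then a^-1 else a) z
  | (None, false) => translate f (copy_shift 1%R z)
  | (None, true) => copy_shift (-1)%R (translate f^-1 z)
  end.

Definition act_word (w : word (option A)) z := foldr act_letter z w.

Lemma act_word_cat v w z : act_word (v ++ w) z = act_word v (act_word w z).
Proof. by rewrite /act_word foldr_cat. Qed.

(** The conjugation relation is respected because the shift commutes with [H], so that the stable
    letter conjugates [h] just as [f] does, namely to [alpha h]. *)
Lemma act_word_eqv v w : pres_eqv (hnn_rel H alpha) v w -> act_word v =1 act_word w.
Proof.
elim=> {v w} [_ _ [a b|h Hh]|[a|] e|v v' w w' _ IH1 _ IH2||v w _ IH|u v w _ IH1 _ IH2] z //=.
- by rewrite translateM.
- rewrite -f_conj// !translateM shift_translate// shiftD subrr shift0//.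
- by case: e; rewrite /= ?translateK ?translateVK.
- by case: e; rewrite /= ?translateK ?translateVK ?shiftD ?subrr ?addNr ?shift0 ?translateVK.
- by rewrite !act_word_cat IH2 IH1.
- by rewrite IH1 IH2.
Qed.

Definition hnn_act (u : hnn H alpha) := act_word (pres_repr u).

Lemma hnn_act_class w z : hnn_act (pres_class (hnn_rel H alpha) w) z = act_word w z.
Proof. by apply: act_word_eqv; exact: pres_classK. Qed.

Lemma hnn_actM u v z : hnn_act (u * v) z = hnn_act u (hnn_act v z).
Proof.
by rewrite {2 3}/hnn_act -act_word_cat -hnn_act_class.
Qed.

Lemma hnn_act_base a z : hnn_act (hnn_base H alpha a) z = translate a z.
Proof. exact: hnn_act_class. Qed.

Lemma hnn_act1 z : hnn_act 1 z = z.
Proof. exact: hnn_act_class. Qed.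

Let t := (hnn_base H alpha f)^-1 * hnn_stable H alpha.

Lemma hnn_act_t z : hnn_act t z = copy_shift 1%R z.
Proof.
suff : translate f (hnn_act t z) = translate f (copy_shift 1%R z).
  exact: (can_inj (translateK f)).
rewrite -hnn_act_base -hnn_actM mulVKg.
exact: hnn_act_class.
Qed.

Lemma hnn_act_tV z : hnn_act t^-1 z = copy_shift (-1)%R z.
Proof.
rewrite -[in LHS](shift0 z) -(subrr 1%R) -shiftD -hnn_act_t -hnn_actM mulVg.
exact: hnn_act1.
Qed.

Lemma hnn_t_neq1 : t <> 1.
Proof.
by move=> t1; have := hnn_act_t (H, 0%R); rewrite t1 hnn_act1 /copy_shift asboolT.
Qed.

Let H0 : set A * int := (H, 0%R).

Let translate_moved a z : ~ H a -> z.1 = H -> (translate a z).1 <> H.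
Proof. by move=> na zH /(translate_fix a zH). Qed.

(* Following [H] in the copy number 0 of [set A], the two sides of the
   identity end in different copies. *)
Let hnn_commutator s (d : int) a b : (forall z, hnn_act s z = copy_shift d z) ->
  (forall z, hnn_act s^-1 z = copy_shift (- d)%R z) -> d != 0%R -> ~ H a -> ~ H b ->
  s * hnn_base H alpha a * s^-1 * hnn_base H alpha b <>
  hnn_base H alpha b * (s * hnn_base H alpha a * s^-1).
Proof.
move=> sE sVE d0 na nb /(congr1 (fun u => (hnn_act u H0).2)).
rewrite !hnn_actM !hnn_act_base !sE !sVE.
have shift_H e z : z.1 = H -> copy_shift e z = (z.1, z.2 + e)%R.
  by move=> zH; rewrite /copy_shift asboolT.
have shift_nH e z : z.1 <> H -> copy_shift e z = z.
  by move=> zH; rewrite /copy_shift asboolF.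
rewrite [copy_shift (- d)%R (translate b H0)]shift_nH; last exact: translate_moved.
rewrite (shift_H (- d)%R H0)// [copy_shift d (translate a (H0.1, _))]shift_nH; last exact: translate_moved.
(* The left side ends in copy [d] or 0, according to whether [a * b] lies in [H], and the right side
   in copy [- d]. *)
rewrite /copy_shift; case: ifP => _ /=; lia.
Qed.

Lemma hnn_commutator_t a b : ~ H a -> ~ H b ->
  t * hnn_base H alpha a * t^-1 * hnn_base H alpha b <>
  hnn_base H alpha b * (t * hnn_base H alpha a * t^-1).
Proof. exact: (hnn_commutator hnn_act_t hnn_act_tV). Qed.

Lemma hnn_commutator_tV a b : ~ H a -> ~ H b ->
  t^-1 * hnn_base H alpha a * t^-1^-1 * hnn_base H alpha b <>
  hnn_base H alpha b * (t^-1 * hnn_base H alpha a * t^-1^-1).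
Proof.
by apply: (hnn_commutator hnn_act_tV) => // z; rewrite invgK opprK hnn_act_t.
Qed.

End HNNAction.

(** * Limits *)

Lemma eval_word_cat (X : Type) (A : groupType) (s : X -> A) v w :
  eval_word s (v ++ w) = (eval_word s v * eval_word s w).
Proof. by rewrite /eval_word big_cat. Qed.

Lemma eval_word_inv (X : choiceType) (A : groupType) (s : X -> A) w :
  eval_word s (word_inv w) = (eval_word s w)^-1.
Proof.
elim: w => [|[x e] w IH]; first by rewrite /eval_word !big_nil invg1.
rewrite /word_inv /= rev_cons -cats1 eval_word_cat -/(word_inv w) IH.
rewrite -[(x, e) :: w]cat1s eval_word_cat invgM; congr (_ * _).
by rewrite /eval_word !big_seq1 /eval_letter /=; case: e; rewrite ?invgK.
Qed.

Section MultiplicativeGroup.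
Context {A B : groupType} (f : {multiplicative A -> B}).

Lemma multiplicative1 : f 1 = 1.
Proof. by apply: (mulgI (f 1)); rewrite -gmulfM !mulg1. Qed.

Lemma multiplicativeV : {morph f : x / (x^-1)}.
Proof. by move=> x; apply: (mulgI (f x)); rewrite -gmulfM !mulgV multiplicative1. Qed.

End MultiplicativeGroup.

Section Limit.
Context {R : realType} (g_ : nat -> thompson R) {G : groupType} (g y0 y1 : G).
Variable iota : {multiplicative thompson R -> G}.
Hypotheses (iota_x0 : iota x0 = y0) (iota_x1 : iota x1 = y1).
Hypothesis cvg_g : marked_cvg (fun n => [tuple g_ n; x0; x1]) [tuple g; y0; y1].

(** Convergence of marked groups compares only words, so a sequence and its limit are tied together
    by one word that represents them all. *)
Definition word_limit (u_ : nat -> thompson R) (u : G) := exists w : word 'I_3,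
  (forall n, eval_word (tnth [tuple g_ n; x0; x1]) w = u_ n) /\
  eval_word (tnth [tuple g; y0; y1]) w = u.

Lemma word_limitM u_ u v_ v : word_limit u_ u -> word_limit v_ v ->
  word_limit (fun n => u_ n * v_ n) (u * v).
Proof.
move=> [w1 [w1E <-]] [w2 [w2E <-]]; exists (w1 ++ w2).
by split=> [n|]; rewrite eval_word_cat// w1E w2E.
Qed.

Lemma word_limitV u_ u : word_limit u_ u -> word_limit (fun n => (u_ n)^-1) u^-1.
Proof.
move=> [w [wE <-]]; exists (word_inv w).
by split=> [n|]; rewrite eval_word_inv// wE.
Qed.

Lemma word_limit_g : word_limit g_ g.
Proof.
exists [:: (ord0, false)].
by split=> [n|]; rewrite /eval_word big_seq1 /eval_letter /= (tnth_nth 1).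
Qed.

(** The elements with this property form a subgroup containing [x0] and [x1], which generate F. *)
Lemma word_limit_const f : word_limit (fun=> f) (iota f).
Proof.
have : [set: thompson R] f by [].
rewrite -thompson_generated.
move/(_ [set f | word_limit (fun=> f) (iota f)]); apply; split; first split.
- apply/mem_set; exists [::]; rewrite multiplicative1.
  by split=> [n|]; rewrite /eval_word big_nil.
- move=> u v /set_mem Hu /set_mem Hv; apply/mem_set.
  by rewrite /= gmulfM multiplicativeV; exact: word_limitM Hu (word_limitV Hv).
- move=> h /=; rewrite !inE => /orP[/eqP->|/eqP->].
    exists [:: (@Ordinal 3 1 isT, false)].
    by split=> [n|]; rewrite /eval_word big_seq1 /eval_letter /= (tnth_nth 1).
  exists [:: (@Ordinal 3 2 isT, false)].
  by split=> [n|]; rewrite /eval_word big_seq1 /eval_letter /= (tnth_nth 1).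
Qed.

(** Convergence is applied to a word for [u * v^-1]. *)
Lemma word_limit_eq u_ u v_ v : word_limit u_ u -> word_limit v_ v ->
  (u = v -> \forall n \near \oo, u_ n = v_ n) /\
  (u <> v -> \forall n \near \oo, u_ n <> v_ n).
Proof.
move=> ul vl; have [w [wE w1]] := word_limitM ul (word_limitV vl).
have [H1 H2] := (marked_cvgP _ _).1 cvg_g w.
split=> uv.
  have := H1 _; rewrite w1 uv mulgV => /(_ erefl).
  by apply: filterS => n; rewrite wE => /divg1_eq.
have := H2 _; rewrite w1 => /(_ _)-/(_ (fun e => uv (divg1_eq e))).
by apply: filterS => n; rewrite wE => uvn unvn; apply: uvn; rewrite unvn mulgV.
Qed.

End Limit.

Theorem theorem3p1 (R : realType) (g_ : nat -> thompson R)
    (G : groupType) (g y0 y1 : G) :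
  marking [tuple g; y0; y1] ->
  marked_cvg (fun n => [tuple g_ n; x0; x1]) [tuple g; y0; y1] ->
  ~ exists (H : set (thompson R)) (alpha : thompson R -> thompson R)
           (iota : {multiplicative thompson R -> G}),
      [/\ subgroup H, finitely_generated H & embedding_on H alpha] /\
      [/\ iota x0 = y0, iota x1 = y1 & is_hnn_extension iota g H alpha].
Proof.
move=> _ cvg_g [H [alpha [iota [[H_group [s Hs] [alphaM _]] [i0 i1]]]]].
move=> [phi [phi_base phi_stable phi_bij]].
pose lim := word_limit g_ g y0 y1.
have lim_eq := @word_limit_eq R g_ G g y0 y1 cvg_g.
have lim_c f : lim (fun=> f) (iota f) by exact: word_limit_const.
have lim_g : lim g_ g by exact: word_limit_g.
have limM := @word_limitM R g_ G g y0 y1.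
have limV := @word_limitV R g_ G g y0 y1.
have conj_g : \forall n \near \oo, forall h, H h -> g_ n * h * (g_ n)^-1 = alpha h.
  (* For the finitely many generators of [H], only finitely many relations have to hold
     eventually. *)
  have conj_s : \forall n \near \oo, forall h, h \in s ->
      g_ n * h * (g_ n)^-1 = alpha h.
    have : forall h, h \in s -> H h by move=> h hs; rewrite Hs => K [_]; apply.
    elim: s {Hs} => [|h s IH] sH; first by near=> n.
    have : \forall n \near \oo, g_ n * h * (g_ n)^-1 = alpha h.
      have [+ _] := lim_eq _ _ _ _ (limM _ _ _ _ (limM _ _ _ _ lim_g (lim_c h)) (limV _ _ lim_g)) (lim_c (alpha h)).
      apply; rewrite -!phi_base -phi_stable -multiplicativeV -!gmulfM hnn_stableJ//.
      exact/sH/mem_head.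
    have := IH (fun k ks => sH k (@mem_behead _ (h :: s) k ks)).
    apply: filterS2 => n ns nh k; rewrite inE => /predU1P[->//|]; exact: ns.
  apply: filterS conj_s => n ns.
  (* As [alpha] is multiplicative on [H], the relation passes from the generators to the
     subgroup. *)
  suff : H `<=` [set h | H h /\ g_ n * h * (g_ n)^-1 = alpha h].
    by move=> sub h /sub[].
  rewrite {1}Hs; apply: smallest_sub; last first.
    by move=> h hs /=; split; [rewrite Hs => K [_]; apply|exact: ns].
  have [H1 HF] := H_group.
  have a1 : alpha 1 = 1 by apply: (mulgI (alpha 1)); rewrite -alphaM// !mulg1.
  split; first by apply/mem_set; split; [exact: set_mem|rewrite mulg1 mulgV].
  move=> u v /set_mem[/mem_set Hu uE] /set_mem[/mem_set Hv vE].
  have HV : v^-1 \in [in H] by exact: (group_closedV H_group).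
  apply/mem_set; split; first exact/set_mem/HF.
  have aV : alpha v^-1 = (alpha v)^-1.
    by apply: (mulgI (alpha v)); rewrite -alphaM// !mulgV.
  by rewrite alphaM// aV -uE -vE !invgM invgK !mulgA mulgVK.
have [N _ gN] := conj_g.
have fE := gN N (leqnn N).
set f := g_ N in fE.
pose t := (hnn_base H alpha f)^-1 * hnn_stable H alpha.
pose c_ n := f^-1 * g_ n.
have phi_inj : injective phi := bij_inj phi_bij.
have lim_t : lim c_ (phi t).
  rewrite gmulfM multiplicativeV phi_base phi_stable.
  exact: limM _ _ _ _ (limV _ _ (lim_c f)) lim_g.
(* For large [n], both [g_ n] and [f] conjugate [h] to [alpha h]. *)
have c_centralizes : \forall n \near \oo, forall h, H h -> c_ n * h = h * c_ n.
  apply: filterS conj_g => n nE h Hh; apply: (mulgI f).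
  rewrite /c_ !mulgA mulgV mul1g fE// -nE//.
  by rewrite mulgVK.
have [[r [a [b [na nb ar br]]]]|nsep] := pselect (separated H); last first.
  have [_ H1] := lim_eq _ _ _ _ lim_t (lim_c 1).
  have t1 : phi t <> iota 1.
    rewrite multiplicative1 -(multiplicative1 phi) => /phi_inj.
    exact: hnn_t_neq1 fE.
  (* Some [c_ n] is at once different from 1 and in the centralizer of [H], which is trivial without
     separation. *)
  have [n [/(_ _)-/centralizer_trivial cn]] := @filter_ex _ _ _ _ (filterI c_centralizes (H1 t1)).
  by apply; exact: cn.
have lim_a : lim (fun=> a) (phi (hnn_base H alpha a)) by rewrite phi_base.
have lim_b : lim (fun=> b) (phi (hnn_base H alpha b)) by rewrite phi_base.
have lim_tV : lim (fun n => (c_ n)^-1) (phi t^-1).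
  by rewrite multiplicativeV; exact: limV.
have lim_conj u_ u : lim u_ (phi u) -> lim (fun n => (u_ n)^-1) (phi u^-1) ->
    u * hnn_base H alpha a * u^-1 * hnn_base H alpha b <>
      hnn_base H alpha b * (u * hnn_base H alpha a * u^-1) ->
    \forall n \near \oo, u_ n * a * (u_ n)^-1 * b <> b * (u_ n * a * (u_ n)^-1).
  move=> lim_u lim_uV uab.
  have lim_uau := limM _ _ _ _ (limM _ _ _ _ lim_u lim_a) lim_uV.
  have [_] := lim_eq _ _ _ _ (limM _ _ _ _ lim_uau lim_b) (limM _ _ _ _ lim_b lim_uau).
  by apply; rewrite -!gmulfM => /phi_inj.
have near1 := lim_conj _ _ lim_t lim_tV (hnn_commutator_t H_group fE na nb).
have near2 : \forall n \near \oo,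
    (c_ n)^-1 * a * (c_ n)^-1^-1 * b <> b * ((c_ n)^-1 * a * (c_ n)^-1^-1).
  apply: (lim_conj _ _ lim_tV _ (hnn_commutator_tV H_group fE na nb)).
  by rewrite invgK; under eq_fun do rewrite invgK.
(* For one [n], both noncommutation statements hold, yet [c_ n] or its inverse maps [r] to a point
   at most [r]. *)
have [n [n1 n2]] := @filter_ex _ _ _ _ (filterI near1 near2).
have [cr|/ltW cr] := leP (c_ n r) r.
  by apply: n1; exact: thompson_conj_commute ar br cr.
apply: n2; apply: thompson_conj_commute ar br _.
by rewrite -(thompson_le (c_ n)) thompsonVK.
Unshelve. all: by end_near.
Qed.
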